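(* If the geometric realization of $C(n_1,n_2,n_3)$ is a surface without boundary, then it is homeomorphic either to a disjoint union of tori or to a disjoint union of 2-spheres.
   Context: Standing conventions: $N,n_1,n_2,n_3$ are positive integers with $n_1+n_2+n_3=N$ and $1\le n_1\le n_2\le n_3<N$. $C(n_1,n_2,n_3)$ denotes the abstract simplicial complex whose vertex set is $\mathbb{Z}/N$, whose 2-simplices are all sets of the form $\{k,k+n_1,k+n_1+n_2\}$ or $\{k,k-n_1,k-n_1-n_2\}$ for $k\in\mathbb{Z}/N$ (i.e. the orbit of $\{0,n_1,n_1+n_2\}$ under all translations $x\mapsto x+t$ and inversions $x\mapsto t-x$ of $\mathbb{Z}/N$), and whose 1-simplices are all sets $\{k,k+n_i\}$ with $k\in\mathbb{Z}/N$, $i\in\{1,2,3\}$. A surface without boundary is a second countable Hausdorff space locally homeomorphic to open subsets of $\mathbb{R}^2$. *)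

(* Defs.v *)
(* classical reals.  Topological spaces are realised concretely as
   subsets of Euclidean space R^d (points are functions nat -> R whose
   coordinates of index >= d vanish), with the subspace topology induced by the
   Euclidean metric. *)
From Stdlib Require Import Reals List Arith.
Import ListNotations.
Open Scope R_scope.

Fixpoint rsum (d : nat) (f : nat -> R) : R :=
  match d with
  | O => 0
  | S d' => rsum d' f + f d'
  end.

Definition in_Rd (d : nat) (x : nat -> R) : Prop :=
  forall i, (d <= i)%nat -> x i = 0.

Definition dist (d : nat) (x y : nat -> R) : R :=
  sqrt (rsum d (fun i => (x i - y i) ^ 2)).

Definition space := (nat -> R) -> Prop.

Definition continuous_on (d1 d2 : nat) (A : space) (f : (nat -> R) -> (nat -> R)) : Prop :=
  forall x, A x -> forall eps, 0 < eps ->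
    exists delta, 0 < delta /\
      forall y, A y -> dist d1 x y < delta -> dist d2 (f x) (f y) < eps.

Definition homeomorphic (d1 : nat) (A : space) (d2 : nat) (B : space) : Prop :=
  exists (f g : (nat -> R) -> (nat -> R)),
    (forall x, A x -> B (f x)) /\ (forall y, B y -> A (g y)) /\
    (forall x, A x -> g (f x) = x) /\ (forall y, B y -> f (g y) = y) /\
    continuous_on d1 d2 A f /\ continuous_on d2 d1 B g.

Definition rel_open (d : nat) (A U : space) : Prop :=
  (forall y, U y -> A y) /\
  forall y, U y -> exists r, 0 < r /\ forall z, A z -> dist d y z < r -> U z.

(* A ⊆ R^d is a surface without boundary: every point has an open
   neighbourhood homeomorphic to an open subset of R^2.  (Hausdorff and second
   countability hold automatically for subspaces of R^d.) *)
Definition is_surface (d : nat) (A : space) : Prop :=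
  (forall x, A x -> in_Rd d x) /\
  forall x, A x -> exists (U V : space),
    U x /\ rel_open d A U /\ rel_open 2 (in_Rd 2) V /\ homeomorphic d U 2 V.

(* the simplices of C(n1,n2,n3), as lists of vertices.  The 2-simplices are the
   orbit of {0,n1,n1+n2} under translations and inversions, i.e. the sets
   {k,k+n1,k+n1+n2} and {k,k-n1,k-n1-n2} (mod N); the 1-simplices are
   {k,k+n_i}; the 0-simplices are the vertices. *)
Definition simplex_C (N n1 n2 n3 : nat) (s : list nat) : Prop :=
  (exists k, (k < N)%nat /\ s = [k]) \/
  (exists k j, (k < N)%nat /\ (j = n1 \/ j = n2 \/ j = n3) /\
     s = [k; ((k + j) mod N)%nat]) \/
  (exists k, (k < N)%nat /\
     (s = [k; ((k + n1) mod N)%nat; ((k + n1 + n2) mod N)%nat] \/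
      s = [k; ((k + (N - n1)) mod N)%nat; ((k + (N - n1) + (N - n2)) mod N)%nat])).

(* geometric realization |C(n1,n2,n3)| ⊆ R^N: barycentric coordinate vectors
   whose support is contained in a simplex of the complex *)
Definition realization (N n1 n2 n3 : nat) : space :=
  fun x =>
    in_Rd N x /\ (forall i, 0 <= x i) /\ rsum N x = 1 /\
    exists s, simplex_C N n1 n2 n3 s /\
      forall i, (i < N)%nat -> x i <> 0 -> In i s.

(* disjoint union of k standard tori: the j-th copy lies in the slice x_3 = j *)
Definition tori (k : nat) : space :=
  fun x => in_Rd 4 x /\
    (exists j, (j < k)%nat /\ x 3%nat = INR j) /\
    (sqrt (x 0%nat ^ 2 + x 1%nat ^ 2) - 2) ^ 2 + x 2%nat ^ 2 = 1.

Definition spheres (k : nat) : space :=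
  fun x => in_Rd 4 x /\
    (exists j, (j < k)%nat /\ x 3%nat = INR j) /\
    x 0%nat ^ 2 + x 1%nat ^ 2 + x 2%nat ^ 2 = 1.

(* Main.v *)
(** The complex [C(n1,n2,n3)] is the quotient of the plane, triangulated with vertex set
    Z^2 and edge directions (1,0), (0,1), (1,1), under the map (a,b) |-> a n1 + b n2 mod N.

    If n1 < n2 < n3 and n3 <> n1 + n2, the six neighbours of a vertex are distinct, so
    that a point of the realization determines its lifts up to the lattice of periods
    {(a,b) : N | a n1 + b n2}.  A compact square times {0, ..., g - 1}, where
    g = gcd(n1,n2,N), then maps onto the realization and onto g tori with the same fibres;
    by compactness the two targets are homeomorphic.  If (n1,n2,n3) = (n,n,2n), the
    realization consists of n boundaries of tetrahedra, which project radially to spheres.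

    In the remaining cases some edge lies in exactly one triangle (n1 = n2 or n2 = n3) or in
    more than two (n3 = n1 + n2), against invariance of domain in the plane.  The latter
    follows from Borsuk's theorem that a map of the square to the plane which is odd on the
    boundary has a zero: otherwise the angle of its values would have a continuous lift, and
    the difference of this lift at antipodal boundary points would be a constant odd multiple
    of pi, although it changes sign when the two points are exchanged. *)

From Stdlib Require Import Reals List Arith ZArith Lia Lra Wf_nat.
From Stdlib Require Import Classical ClassicalEpsilon FunctionalExtensionality.
From Coquelicot Require Import Coquelicot.
Require Import Defs.
Import ListNotations.
Open Scope R_scope.

Lemma forall_lt_2 (P : nat -> Prop) : P 0%nat -> P 1%nat -> forall i, (i < 2)%nat -> P i.
Proof. intros P0 P1 [|[|i]] Hi; [exact P0|exact P1|lia]. Qed.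

Lemma forall_lt_3 (P : nat -> Prop) :
  P 0%nat -> P 1%nat -> P 2%nat -> forall i, (i < 3)%nat -> P i.
Proof. intros P0 P1 P2 [|[|[|i]]] Hi; [exact P0|exact P1|exact P2|lia]. Qed.

Lemma forall_lt_4 (P : nat -> Prop) :
  P 0%nat -> P 1%nat -> P 2%nat -> P 3%nat -> forall i, (i < 4)%nat -> P i.
Proof.
  intros P0 P1 P2 P3 [|[|[|[|i]]]] Hi; [exact P0|exact P1|exact P2|exact P3|lia].
Qed.

(** * Finite sums *)

Lemma rsum_ext d f g : (forall i, (i < d)%nat -> f i = g i) -> rsum d f = rsum d g.
Proof.
  induction d as [|d IH]; intros Hfg; simpl; [reflexivity|].
  rewrite IH, Hfg; [reflexivity|lia|]. intros; apply Hfg; lia.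
Qed.

Lemma rsum_plus d f g : rsum d (fun i => f i + g i) = rsum d f + rsum d g.
Proof. induction d as [|d IH]; simpl; [lra|rewrite IH; lra]. Qed.

Lemma rsum_scal d k f : rsum d (fun i => k * f i) = k * rsum d f.
Proof. induction d as [|d IH]; simpl; [lra|rewrite IH; lra]. Qed.

Lemma rsum_const d k : rsum d (fun _ => k) = INR d * k.
Proof. induction d as [|d IH]; [simpl; lra|]. rewrite S_INR; cbn [rsum]; lra. Qed.

Lemma rsum_0 d f : (forall i, (i < d)%nat -> f i = 0) -> rsum d f = 0.
Proof.
  intros Hf; rewrite (rsum_ext d f (fun _ => 0) Hf), rsum_const; ring.
Qed.

Lemma rsum_le d f g : (forall i, (i < d)%nat -> f i <= g i) -> rsum d f <= rsum d g.
Proof.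
  induction d as [|d IH]; intros Hfg; simpl; [lra|].
  apply Rplus_le_compat; [apply IH; intros; apply Hfg; lia|apply Hfg; lia].
Qed.

Lemma rsum_nonneg d f : (forall i, (i < d)%nat -> 0 <= f i) -> 0 <= rsum d f.
Proof. intros Hf; rewrite <- (rsum_0 d (fun _ => 0)) by reflexivity; apply rsum_le, Hf. Qed.

Lemma rsum_swap d e f :
  rsum d (fun i => rsum e (fun j => f i j)) = rsum e (fun j => rsum d (fun i => f i j)).
Proof.
  induction d as [|d IH]; simpl.
  - rewrite rsum_0; reflexivity.
  - rewrite IH, <- rsum_plus; reflexivity.
Qed.

Definition kronecker (a i : nat) : R := if Nat.eqb i a then 1 else 0.

Lemma kronecker_same a : kronecker a a = 1.
Proof. unfold kronecker; rewrite Nat.eqb_refl; reflexivity. Qed.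

Lemma kronecker_diff a i : i <> a -> kronecker a i = 0.
Proof. intros Hia; unfold kronecker; rewrite (proj2 (Nat.eqb_neq i a) Hia); reflexivity. Qed.

Lemma kronecker_nonneg a i : 0 <= kronecker a i.
Proof. unfold kronecker; destruct (Nat.eqb i a); lra. Qed.

Lemma rsum_kronecker_mul d a f : (a < d)%nat -> rsum d (fun i => kronecker a i * f i) = f a.
Proof.
  induction d as [|d IH]; intros Ha; [lia|]; simpl.
  destruct (Nat.eq_dec a d) as [->|Hne].
  - rewrite rsum_0, kronecker_same; [lra|].
    intros i Hi; rewrite kronecker_diff; [lra|lia].
  - rewrite IH, kronecker_diff; [lra|lia|lia].
Qed.

Lemma rsum_kronecker d a : (a < d)%nat -> rsum d (kronecker a) = 1.
Proof.
  intros Ha; rewrite (rsum_ext d _ (fun i => kronecker a i * 1)) by (intros; lra).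
  apply (rsum_kronecker_mul d a (fun _ => 1) Ha).
Qed.

Lemma rsum_term_le d f i :
  (forall j, (j < d)%nat -> 0 <= f j) -> (i < d)%nat -> f i <= rsum d f.
Proof.
  intros Hf Hi; rewrite <- (rsum_kronecker_mul d i f Hi); apply rsum_le.
  intros j Hj; specialize (Hf j Hj); unfold kronecker; destruct (Nat.eqb j i); lra.
Qed.

Lemma rsum_pos d f k :
  (forall i, (i < d)%nat -> 0 <= f i) -> (k < d)%nat -> 0 < f k -> 0 < rsum d f.
Proof. intros Hf Hk Hpos; apply Rlt_le_trans with (f k); [exact Hpos|apply rsum_term_le; auto]. Qed.

Lemma rsum_nonzero_term d f : rsum d f <> 0 -> exists i, (i < d)%nat /\ f i <> 0.
Proof.
  intros Hf; apply NNPP; intros Hnone; apply Hf, rsum_0; intros i Hi.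
  apply NNPP; intros Hfi; apply Hnone; eauto.
Qed.

(** * Neighbourhoods and continuity *)

Definition near (d : nat) (A : space) (x : nat -> R) : ((nat -> R) -> Prop) -> Prop :=
  within A (locally_dist (dist d x)).

#[local] Instance near_filter d A x : Filter (near d A x).
Proof. apply within_filter, locally_dist_filter. Qed.

Lemma filter_forall_lt {T : Type} (F : (T -> Prop) -> Prop) {FF : Filter F} m
  (P : nat -> T -> Prop) :
  (forall i, (i < m)%nat -> F (P i)) -> F (fun y => forall i, (i < m)%nat -> P i y).
Proof.
  induction m as [|m IH]; intros HP.
  - apply filter_forall; intros; lia.
  - assert (Hlast : F (P m)) by (apply HP; lia).
    assert (Hinit : F (fun y => forall i, (i < m)%nat -> P i y))
      by (apply IH; intros; apply HP; lia).
    generalize (filter_and _ _ Hlast Hinit); apply filter_imp; intros y [Hm Hlt] i Hi.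
    destruct (Nat.eq_dec i m) as [->|]; [exact Hm|apply Hlt; lia].
Qed.

Lemma coord_le_dist d x y i : (i < d)%nat -> Rabs (x i - y i) <= dist d x y.
Proof.
  intros Hi; unfold dist; rewrite <- sqrt_Rsqr_abs, Rsqr_pow2; apply sqrt_le_1_alt.
  apply (rsum_term_le d (fun i => (x i - y i) ^ 2)); [|exact Hi].
  intros; apply pow2_ge_0.
Qed.

Lemma dist_le_sum_abs d x y : dist d x y <= rsum d (fun i => Rabs (x i - y i)).
Proof.
  assert (Habs : forall k, 0 <= rsum k (fun i => Rabs (x i - y i)))
    by (intros k; apply rsum_nonneg; intros; apply Rabs_pos).
  rewrite <- (sqrt_pow2 (rsum d _)) by apply Habs. apply sqrt_le_1_alt.
  induction d as [|d IH]; cbn [rsum]; [lra|].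
  rewrite <- (pow2_abs (x d - y d)).
  assert (0 <= Rabs (x d - y d)) by apply Rabs_pos.
  specialize (Habs d). nra.
Qed.

Lemma near_coords d A x P :
  near d A x P <->
  exists e, 0 < e /\ forall y, A y -> (forall i, (i < d)%nat -> Rabs (y i - x i) < e) -> P y.
Proof.
  split.
  - intros [e HP]. assert (Hd := pos_INR d). assert (He := cond_pos e).
    exists (e / (INR d + 1)); split; [apply Rdiv_lt_0_compat; lra|].
    intros y Hy Hclose; apply HP; [|exact Hy].
    apply Rle_lt_trans with (rsum d (fun _ => e / (INR d + 1))).
    + eapply Rle_trans; [apply dist_le_sum_abs|].
      apply rsum_le; intros i Hi; rewrite Rabs_minus_sym; left; auto.
    + rewrite rsum_const. apply (Rmult_lt_reg_r (INR d + 1)); [lra|].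
      unfold Rdiv; rewrite !Rmult_assoc, Rinv_l by lra; lra.
  - intros (e & He & HP); exists (mkposreal e He); intros y Hd Hy; apply HP; [exact Hy|].
    intros i Hi; rewrite Rabs_minus_sym.
    eapply Rle_lt_trans; [apply coord_le_dist, Hi|exact Hd].
Qed.

Lemma near_close_coords d A x e :
  0 < e -> near d A x (fun y => forall i, (i < d)%nat -> Rabs (y i - x i) < e).
Proof. intros He; apply near_coords; exists e; auto. Qed.

Lemma near_in d A x : near d A x A.
Proof. apply near_coords; exists 1; split; [lra|auto]. Qed.

Lemma near_subspace d A B x P :
  near d A x B -> near d B x P -> near d A x P.
Proof.
  intros HB HP.
  assert (HBP : near d A x (fun y => B y -> P y)).
  { destruct HP as [e HP]; exists e; intros y Hd _; apply HP, Hd. }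
  generalize (filter_and _ _ HB HBP); apply filter_imp; tauto.
Qed.

Lemma rel_open_near d A U x : rel_open d A U -> U x -> near d A x U.
Proof.
  intros [_ Hopen] Hx; destruct (Hopen x Hx) as (r & Hr & HU).
  exists (mkposreal r Hr); intros y Hd Hy; apply HU; assumption.
Qed.

Definition continuous_real (d : nat) (A : space) (h : (nat -> R) -> R) : Prop :=
  forall x, A x -> filterlim h (near d A x) (locally (h x)).

Lemma continuous_real_near d A h x e :
  continuous_real d A h -> A x -> 0 < e -> near d A x (fun y => Rabs (h y - h x) < e).
Proof. intros Hh Hx He. exact (Hh x Hx _ (locally_ball (h x) (mkposreal e He))). Qed.

Lemma near_continuous_real d A h :
  (forall x e, A x -> 0 < e -> near d A x (fun y => Rabs (h y - h x) < e)) ->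
  continuous_real d A h.
Proof.
  intros Hh x Hx P [e He]; unfold filtermap.
  generalize (Hh x e Hx (cond_pos e)); apply filter_imp; intros y Hy; apply He, Hy.
Qed.

Lemma continuous_real_ext d A h k :
  (forall x, A x -> h x = k x) -> continuous_real d A h -> continuous_real d A k.
Proof.
  intros Ehk Hh x Hx. rewrite <- Ehk by exact Hx.
  apply (filterlim_ext_loc h); [|apply Hh, Hx].
  generalize (near_in d A x); apply filter_imp; exact Ehk.
Qed.

Lemma continuous_real_const d A k : continuous_real d A (fun _ => k).
Proof. intros x _; apply filterlim_const. Qed.

Lemma continuous_real_coord d A i : (i < d)%nat -> continuous_real d A (fun x => x i).
Proof.
  intros Hi; apply near_continuous_real; intros x e Hx He.
  generalize (near_close_coords d A x e He); apply filter_imp; auto.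
Qed.

Lemma continuous_real_plus d A h k :
  continuous_real d A h -> continuous_real d A k -> continuous_real d A (fun x => h x + k x).
Proof.
  intros Hh Hk x Hx. eapply filterlim_comp_2; [apply Hh, Hx|apply Hk, Hx|].
  apply (filterlim_plus (V := R_NormedModule)).
Qed.

Lemma continuous_real_mult d A h k :
  continuous_real d A h -> continuous_real d A k -> continuous_real d A (fun x => h x * k x).
Proof.
  intros Hh Hk x Hx. eapply filterlim_comp_2; [apply Hh, Hx|apply Hk, Hx|].
  apply (filterlim_mult (K := R_AbsRing)).
Qed.

Lemma continuous_real_comp d A h (k : R -> R) :
  continuous_real d A h -> (forall x, A x -> continuous k (h x)) ->
  continuous_real d A (fun x => k (h x)).
Proof. intros Hh Hk x Hx. eapply filterlim_comp; [apply Hh, Hx|apply Hk, Hx]. Qed.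

Lemma continuous_real_opp d A h :
  continuous_real d A h -> continuous_real d A (fun x => - h x).
Proof.
  intros Hh; apply (continuous_real_ext d A (fun x => (-1) * h x)); [intros; ring|].
  apply continuous_real_mult; [apply continuous_real_const|exact Hh].
Qed.

Lemma continuous_real_minus d A h k :
  continuous_real d A h -> continuous_real d A k -> continuous_real d A (fun x => h x - k x).
Proof. intros; apply continuous_real_plus; [|apply continuous_real_opp]; assumption. Qed.

Lemma continuous_real_abs d A h :
  continuous_real d A h -> continuous_real d A (fun x => Rabs (h x)).
Proof. intros Hh; apply continuous_real_comp; [exact Hh|intros; apply continuous_Rabs]. Qed.

Lemma continuous_real_max d A h k :
  continuous_real d A h -> continuous_real d A k -> continuous_real d A (fun x => Rmax (h x) (k x)).
Proof.
  intros Hh Hk.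
  apply (continuous_real_ext d A (fun x => (h x + k x + Rabs (h x - k x)) * / 2)).
  - intros x _; unfold Rmax, Rabs; destruct (Rle_dec _ _), (Rcase_abs _); lra.
  - apply continuous_real_mult; [|apply continuous_real_const].
    apply continuous_real_plus; [apply continuous_real_plus; assumption|].
    apply continuous_real_abs, continuous_real_minus; assumption.
Qed.

Lemma continuous_real_min d A h k :
  continuous_real d A h -> continuous_real d A k -> continuous_real d A (fun x => Rmin (h x) (k x)).
Proof.
  intros Hh Hk; apply (continuous_real_ext d A (fun x => - Rmax (- h x) (- k x))).
  - intros x _; rewrite <- Ropp_Rmin; ring.
  - apply continuous_real_opp, continuous_real_max; apply continuous_real_opp; assumption.
Qed.

Lemma continuous_real_div d A h k :
  continuous_real d A h -> continuous_real d A k -> (forall x, A x -> k x <> 0) ->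
  continuous_real d A (fun x => h x / k x).
Proof.
  intros Hh Hk Hk0; apply continuous_real_mult; [exact Hh|].
  apply continuous_real_comp; [exact Hk|]. intros x Hx; apply continuous_Rinv, Hk0, Hx.
Qed.

Lemma continuous_real_pow d A h n :
  continuous_real d A h -> continuous_real d A (fun x => h x ^ n).
Proof.
  intros Hh; induction n as [|n IH]; simpl; [apply continuous_real_const|].
  apply continuous_real_mult; assumption.
Qed.

Lemma continuous_real_rsum d A m (h : nat -> (nat -> R) -> R) :
  (forall j, (j < m)%nat -> continuous_real d A (h j)) ->
  continuous_real d A (fun x => rsum m (fun j => h j x)).
Proof.
  induction m as [|m IH]; intros Hh; simpl; [apply continuous_real_const|].
  apply continuous_real_plus; [apply IH; intros; apply Hh; lia|apply Hh; lia].
Qed.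

Ltac continuity_real :=
  lazymatch goal with
  | |- continuous_real _ _ (fun _ => ?c) => apply continuous_real_const
  | |- continuous_real ?d ?A (fun x => x ?i) => apply (continuous_real_coord d A i); try lia
  | |- continuous_real ?d ?A (fun x => @?h x + @?k x) =>
      apply (continuous_real_plus d A h k); continuity_real
  | |- continuous_real ?d ?A (fun x => @?h x - @?k x) =>
      apply (continuous_real_minus d A h k); continuity_real
  | |- continuous_real ?d ?A (fun x => @?h x * @?k x) =>
      apply (continuous_real_mult d A h k); continuity_real
  | |- continuous_real ?d ?A (fun x => @?h x / @?k x) =>
      apply (continuous_real_div d A h k); continuity_real
  | |- continuous_real ?d ?A (fun x => - @?h x) =>
      apply (continuous_real_opp d A h); continuity_real
  | |- continuous_real ?d ?A (fun x => Rabs (@?h x)) =>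
      apply (continuous_real_abs d A h); continuity_real
  | |- continuous_real ?d ?A (fun x => Rmax (@?h x) (@?k x)) =>
      apply (continuous_real_max d A h k); continuity_real
  | |- continuous_real ?d ?A (fun x => Rmin (@?h x) (@?k x)) =>
      apply (continuous_real_min d A h k); continuity_real
  | |- continuous_real ?d ?A (fun x => @?h x ^ ?n) =>
      apply (continuous_real_pow d A h n); continuity_real
  | |- continuous_real ?d ?A (fun x => sqrt (@?h x)) =>
      apply (continuous_real_comp d A h sqrt);
      [continuity_real|intros; apply continuous_sqrt]
  | |- continuous_real ?d ?A (fun x => cos (@?h x)) =>
      apply (continuous_real_comp d A h cos); [continuity_real|intros; apply continuous_cos]
  | |- continuous_real ?d ?A (fun x => sin (@?h x)) =>
      apply (continuous_real_comp d A h sin); [continuity_real|intros; apply continuous_sin]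
  | |- continuous_real ?d ?A (fun x => rsum ?m (fun j => @?h j x)) =>
      apply (continuous_real_rsum d A m h); intros; cbv beta; continuity_real
  | _ => idtac
  end.

Lemma continuous_on_near d1 d2 A B f x P :
  (forall y, A y -> B (f y)) -> continuous_on d1 d2 A f -> A x -> near d2 B (f x) P ->
  near d1 A x (fun y => P (f y)).
Proof.
  intros HAB Hf Hx [e HP]. destruct (Hf x Hx e (cond_pos e)) as (r & Hr & Hfr).
  exists (mkposreal r Hr); intros y Hd Hy; apply HP; auto.
Qed.

Lemma continuous_on_coords d1 d2 A f :
  continuous_on d1 d2 A f <->
  forall i, (i < d2)%nat -> continuous_real d1 A (fun x => f x i).
Proof.
  split.
  - intros Hf i Hi; apply near_continuous_real; intros x e Hx He.
    apply (continuous_on_near d1 d2 A (fun _ => True) f x (fun y => Rabs (y i - f x i) < e)); auto.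
    generalize (near_close_coords d2 (fun _ => True) (f x) e He); apply filter_imp; auto.
  - intros Hf x Hx e He.
    assert (Hball : near d2 (fun _ => True) (f x) (fun y => dist d2 (f x) y < e))
      by (exists (mkposreal e He); auto).
    apply near_coords in Hball; destruct Hball as (e' & He' & Hball).
    destruct (filter_forall_lt (near d1 A x) d2 (fun i y => Rabs (f y i - f x i) < e'))
      as [r Hr].
    + intros i Hi; apply (continuous_real_near d1 A (fun x => f x i)); auto.
    + exists r; split; [apply cond_pos|]; intros y Hy Hd; apply Hball; auto.
Qed.

Lemma continuous_real_comp_map d1 d2 A B f h :
  (forall x, A x -> B (f x)) -> continuous_on d1 d2 A f -> continuous_real d2 B h ->
  continuous_real d1 A (fun x => h (f x)).
Proof.
  intros HAB Hf Hh x Hx P HP. apply (continuous_on_near d1 d2 A B f x (fun y => P (h y))); auto.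
  apply (Hh (f x) (HAB x Hx) P HP).
Qed.

Lemma continuous_on_comp d1 d2 d3 A B f g :
  (forall x, A x -> B (f x)) -> continuous_on d1 d2 A f -> continuous_on d2 d3 B g ->
  continuous_on d1 d3 A (fun x => g (f x)).
Proof.
  intros HAB Hf Hg; apply continuous_on_coords; intros i Hi.
  apply (continuous_real_comp_map d1 d2 A B f (fun y => g y i)); auto.
  revert i Hi; apply continuous_on_coords, Hg.
Qed.

(** * Compactness *)

Lemma in_Rd_ext d x y :
  in_Rd d x -> in_Rd d y -> (forall i, (i < d)%nat -> x i = y i) -> x = y.
Proof.
  intros Hx Hy Hxy; apply functional_extensionality; intros i.
  destruct (Nat.lt_ge_cases i d) as [Hi|Hi]; [apply Hxy, Hi|].
  rewrite Hx, Hy; [reflexivity|exact Hi|exact Hi].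
Qed.

Definition cluster (d : nat) (K : space) (u : nat -> nat -> R) (l : nat -> R) : Prop :=
  forall P, near d K l P -> forall n, exists m, (n <= m)%nat /\ P (u m).

Definition seq_compact (d : nat) (K : space) : Prop :=
  forall u : nat -> nat -> R, (forall n, K (u n)) -> exists l, K l /\ cluster d K u l.

Definition adherent (d : nat) (K : space) (l : nat -> R) : Prop :=
  forall P, near d (fun _ => True) l P -> exists y, K y /\ P y.

Lemma inv_INR_lt (e : R) : 0 < e -> exists n0, forall n, (n0 <= n)%nat -> / (INR n + 1) < e.
Proof.
  intros He; destruct (archimed_cor1 e He) as (n0 & Hn0 & Hpos).
  exists n0; intros n Hn; eapply Rlt_trans; [|exact Hn0].
  apply lt_0_INR in Hpos; apply le_INR in Hn; apply Rinv_lt_contravar; nra.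
Qed.

Lemma bounded_subsequence (v : nat -> R) B :
  (forall n, Rabs (v n) <= B) ->
  exists (phi : nat -> nat) (l : R),
    (forall n, (n <= phi n)%nat) /\ is_lim_seq (fun n => v (phi n)) l.
Proof.
  intros HB.
  destruct (Bolzano_Weierstrass v (fun c => - B <= c <= B) (compact_P3 (- B) B)) as [l Hl].
  { intros n; apply Rabs_le_between, HB. }
  assert (Hclose : forall n : nat, exists m, (n <= m)%nat /\ Rabs (v m - l) < / (INR n + 1)).
  { intros n; destruct (Hl (fun y => Rabs (y - l) < / (INR n + 1)) n) as (m & Hm & Hv); eauto.
    exists (mkposreal _ (RinvN_pos n)); intros y Hy; exact Hy. }
  destruct (choice _ Hclose) as [phi Hphi].
  exists phi, l; split; [apply Hphi|].
  apply is_lim_seq_spec; intros e. destruct (inv_INR_lt e (cond_pos e)) as [n0 Hn0].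
  exists n0; intros n Hn; eapply Rlt_trans; [apply Hphi|apply Hn0, Hn].
Qed.

Lemma bounded_subsequence_Rd d (u : nat -> nat -> R) B :
  (forall n i, (i < d)%nat -> Rabs (u n i) <= B) ->
  exists (phi : nat -> nat) l, (forall n, (n <= phi n)%nat) /\
    forall i, (i < d)%nat -> is_lim_seq (fun n => u (phi n) i) (Finite (l i)).
Proof.
  induction d as [|d IH]; intros HB.
  - exists (fun n => n), (fun _ => 0); split; intros; lia.
  - destruct IH as (phi & l & Hphi & Hl); [intros; apply HB; lia|].
    destruct (bounded_subsequence (fun n => u (phi n) d) B) as (psi & m & Hpsi & Hm);
      [intros; apply HB; lia|].
    exists (fun n => phi (psi n)), (fun i => if Nat.eqb i d then m else l i); split.
    + intros n; eapply Nat.le_trans; [apply Hpsi|apply Hphi].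
    + intros i Hi. destruct (Nat.eqb_spec i d) as [->|Hne]; [exact Hm|].
      apply (is_lim_seq_subseq (fun n => u (phi n) i)); [|apply Hl; lia].
      intros P [n0 HP]; exists n0; intros n Hn; apply HP; eapply Nat.le_trans; eauto.
Qed.

Lemma closed_bounded_compact d (K : space) B :
  (forall x, K x -> in_Rd d x) ->
  (forall x i, K x -> (i < d)%nat -> Rabs (x i) <= B) ->
  (forall l, in_Rd d l -> adherent d K l -> K l) ->
  seq_compact d K.
Proof.
  intros Hin HB Hclosed u Hu.
  destruct (bounded_subsequence_Rd d u B) as (phi & l & Hphi & Hl); [auto|].
  set (l' := fun i => if Nat.ltb i d then l i else 0).
  assert (Hcl : forall e, 0 < e -> forall n, exists m, (n <= m)%nat /\
    forall i, (i < d)%nat -> Rabs (u m i - l' i) < e).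
  { intros e He n.
    destruct (filter_forall_lt eventually d (fun i k => Rabs (u (phi k) i - l i) < e))
      as [n0 Hn0].
    { intros i Hi. apply (proj2 (is_lim_seq_spec _ _) (Hl i Hi) (mkposreal e He)). }
    exists (phi (Nat.max n n0)); split; [specialize (Hphi (Nat.max n n0)); lia|].
    intros i Hi; unfold l'; rewrite (proj2 (Nat.ltb_lt i d) Hi); apply Hn0; lia. }
  exists l'; split.
  - apply Hclosed.
    + intros i Hi; unfold l'; rewrite (proj2 (Nat.ltb_ge i d) Hi); reflexivity.
    + intros P HP; apply near_coords in HP; destruct HP as (e & He & HP).
      destruct (Hcl e He O) as (m & _ & Hm); eauto.
  - intros P HP n; apply near_coords in HP; destruct HP as (e & He & HP).
    destruct (Hcl e He n) as (m & Hnm & Hm); eauto.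
Qed.

Lemma adherent_exists_lt d K C m l :
  (forall x, K x -> exists j : nat, (j < m)%nat /\ C j x) -> adherent d K l ->
  exists j, (j < m)%nat /\ adherent d (C j) l.
Proof.
  intros HK Hl; apply NNPP; intros Hnone.
  destruct (Hl (fun y => forall j, (j < m)%nat -> ~ C j y)) as (y & Hy & Hout).
  - apply (filter_forall_lt _ m (fun j y => ~ C j y)); intros j Hj.
    assert (Hnot : ~ adherent d (C j) l) by (intros Hadh; apply Hnone; eauto).
    apply not_all_ex_not in Hnot; destruct Hnot as [P HP].
    apply imply_to_and in HP; destruct HP as [HP HCP].
    generalize HP; apply filter_imp; intros z Hz HC; apply HCP; eauto.
  - destruct (HK y Hy) as (j & Hj & HC); exact (Hout j Hj HC).
Qed.

Lemma adherent_le d K h l c :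
  continuous_real d (fun _ => True) h -> (forall x, K x -> h x <= c) -> adherent d K l ->
  h l <= c.
Proof.
  intros Hh HK Hl; apply Rnot_lt_le; intros Hlt.
  destruct (Hl _ (continuous_real_near d _ h l (h l - c) Hh I ltac:(lra))) as (y & HKy & Hy).
  specialize (HK y HKy); apply Rabs_lt_between in Hy; lra.
Qed.

Lemma adherent_ge d K h l c :
  continuous_real d (fun _ => True) h -> (forall x, K x -> c <= h x) -> adherent d K l ->
  c <= h l.
Proof.
  intros Hh HK Hl; apply Ropp_le_cancel, (adherent_le d K (fun x => - h x) l); auto.
  - apply continuous_real_opp, Hh.
  - intros x Hx; apply Ropp_le_contravar, HK, Hx.
Qed.

Lemma adherent_eq d K h l c :
  continuous_real d (fun _ => True) h -> (forall x, K x -> h x = c) -> adherent d K l ->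
  h l = c.
Proof.
  intros Hh HK Hl; apply Rle_antisym; [eapply adherent_le|eapply adherent_ge]; eauto;
    intros x Hx; right; [|symmetry]; auto.
Qed.

Lemma compact_cluster d K (P : nat -> (nat -> R) -> Prop) :
  seq_compact d K -> (forall n, exists x, K x /\ P n x) ->
  exists l, K l /\ forall Q, near d K l Q ->
    forall n, exists m x, (n <= m)%nat /\ K x /\ P m x /\ Q x.
Proof.
  intros HK HP; destruct (choice _ HP) as [u Hu].
  destruct (HK u) as (l & Hl & Hcl); [apply Hu|].
  exists l; split; [exact Hl|]; intros Q HQ n.
  destruct (Hcl Q HQ n) as (m & Hm & HQm). destruct (Hu m). exists m, (u m); auto.
Qed.

Lemma compact_positive_lower_bound d K h :
  seq_compact d K -> continuous_real d K h -> (forall x, K x -> 0 < h x) ->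
  exists e, 0 < e /\ forall x, K x -> e <= h x.
Proof.
  intros HK Hh Hpos; apply NNPP; intros Hnone.
  destruct (compact_cluster d K (fun n x => h x < / (INR n + 1)) HK) as (l & Hl & Hcl).
  { intros n; apply NNPP; intros Hn; apply Hnone.
    exists (/ (INR n + 1)); split; [apply RinvN_pos|].
    intros x Hx; apply Rnot_lt_le; eauto. }
  assert (Hhl : 0 < h l / 2) by (specialize (Hpos l Hl); lra).
  destruct (inv_INR_lt _ Hhl) as [n0 Hn0].
  destruct (Hcl _ (continuous_real_near d K h l _ Hh Hl Hhl) n0) as (m & x & Hm & _ & Hx & Hxl).
  apply Rabs_lt_between in Hxl; specialize (Hn0 m Hm); lra.
Qed.

Lemma quotient_map_continuous d d1 d2 (K X : space) G H f :
  seq_compact d K -> (forall x, X x -> in_Rd d1 x) ->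
  (forall p, K p -> X (G p)) -> (forall x, X x -> exists p, K p /\ G p = x) ->
  continuous_on d d1 K G -> continuous_on d d2 K H ->
  (forall p, K p -> f (G p) = H p) ->
  continuous_on d1 d2 X f.
Proof.
  intros HK HX HGX Hsurj HG HH Hf x Hx e He; apply NNPP; intros Hnone.
  destruct (compact_cluster d K
    (fun n p => dist d1 x (G p) < / (INR n + 1) /\ e <= dist d2 (f x) (H p)) HK)
    as (l & Hl & Hcl).
  { intros n; apply NNPP; intros Hn; apply Hnone.
    exists (/ (INR n + 1)); split; [apply RinvN_pos|].
    intros y Hy Hd. destruct (Hsurj y Hy) as (p & Hp & <-).
    apply Rnot_le_lt; intros Hle; apply Hn; exists p; rewrite <- (Hf p Hp); auto. }
  assert (Exl : x = G l).
  { apply (in_Rd_ext d1); auto; intros i Hi; apply Rminus_diag_uniq, NNPP; intros Hne.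
    assert (Hhalf : 0 < Rabs (x i - G l i) / 2)
      by (assert (Hpos := Rabs_pos_lt _ Hne); lra).
    destruct (inv_INR_lt _ Hhalf) as [n0 Hn0].
    assert (HGi := proj1 (continuous_on_coords d d1 K G) HG i Hi).
    destruct (Hcl _ (continuous_real_near d K _ l _ HGi Hl Hhalf) n0)
      as (m & p & Hm & _ & [Hxp _] & Hlp).
    specialize (Hn0 m Hm). assert (Hxi := coord_le_dist d1 x (G p) i Hi).
    assert (Htri := Rabs_triang (x i - G p i) (G p i - G l i)).
    replace (x i - G p i + (G p i - G l i)) with (x i - G l i) in Htri by ring.
    lra. }
  destruct (HH l Hl e He) as (r & Hr & HHl).
  assert (Hnear : near d K l (fun p => dist d2 (H l) (H p) < e))
    by (exists (mkposreal r Hr); intros p Hd Hp; apply HHl; assumption).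
  destruct (Hcl _ Hnear O) as (m & p & _ & _ & [_ Hfar] & Hclose).
  rewrite Exl, (Hf l Hl) in Hfar; lra.
Qed.

Lemma homeomorphic_of_same_fibres d d1 d2 (K X Y : space) G H :
  seq_compact d K ->
  (forall x, X x -> in_Rd d1 x) -> (forall y, Y y -> in_Rd d2 y) ->
  (forall p, K p -> X (G p)) -> (forall x, X x -> exists p, K p /\ G p = x) ->
  (forall p, K p -> Y (H p)) -> (forall y, Y y -> exists p, K p /\ H p = y) ->
  continuous_on d d1 K G -> continuous_on d d2 K H ->
  (forall p q, K p -> K q -> (G p = G q <-> H p = H q)) ->
  homeomorphic d1 X d2 Y.
Proof.
  intros HK HX HY HGX HGs HHY HHs HGc HHc Hfib.
  set (section := fun (F : (nat -> R) -> (nat -> R)) x =>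
    epsilon (inhabits (fun _ : nat => 0)) (fun p => K p /\ F p = x)).
  assert (HsG : forall x, X x -> K (section G x) /\ G (section G x) = x)
    by (intros x Hx; apply epsilon_spec, HGs, Hx).
  assert (HsH : forall y, Y y -> K (section H y) /\ H (section H y) = y)
    by (intros y Hy; apply epsilon_spec, HHs, Hy).
  assert (EH : forall p, K p -> H (section G (G p)) = H p).
  { intros p Hp; destruct (HsG (G p) (HGX p Hp)); apply Hfib; auto. }
  assert (EG : forall p, K p -> G (section H (H p)) = G p).
  { intros p Hp; destruct (HsH (H p) (HHY p Hp)); apply Hfib; auto. }
  exists (fun x => H (section G x)), (fun y => G (section H y)); repeat split.
  - intros x Hx; apply HHY, HsG, Hx.
  - intros y Hy; apply HGX, HsH, Hy.
  - intros x Hx; destruct (HsG x Hx) as [HKs Es]; rewrite EG; assumption.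
  - intros y Hy; destruct (HsH y Hy) as [HKs Es]; rewrite EH; assumption.
  - apply (quotient_map_continuous d d1 d2 K X G H); auto.
  - apply (quotient_map_continuous d d2 d1 K Y H G); auto.
Qed.

(** * Antipodal labellings of a grid *)

Section AntipodalGrid.
Local Open Scope Z_scope.

Definition opposite (a b : Z) : Prop := (b - a) mod 4 = 2.

Definition turn (a b : Z) : Z := (b - a + 1) mod 4 - 1.

Lemma turn_mod a b : (turn a b - (b - a)) mod 4 = 0.
Proof. unfold turn; Z.to_euclidean_division_equations; lia. Qed.

Lemma turn_bound a b : ~ opposite a b -> -1 <= turn a b <= 1.
Proof. unfold turn, opposite; Z.to_euclidean_division_equations; lia. Qed.

Lemma turn_triangle a b c :
  ~ opposite a b -> ~ opposite b c -> ~ opposite a c -> turn a b + turn b c = turn a c.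
Proof. unfold turn, opposite; Z.to_euclidean_division_equations; lia. Qed.

Section GridLift.

Variable n : nat.
Variable L : nat -> nat -> Z.

Fixpoint lift_bottom (i : nat) : Z :=
  match i with
  | O => L 0 0
  | S i' => lift_bottom i' + turn (L i' 0) (L i 0)
  end.

Fixpoint lift (i j : nat) : Z :=
  match j with
  | O => lift_bottom i
  | S j' => lift i j' + turn (L i j') (L i j)
  end.

Lemma lift_mod i j : (lift i j - L i j) mod 4 = 0.
Proof.
  induction j as [|j IHj]; cbn [lift].
  - induction i as [|i IHi]; cbn [lift_bottom]; [rewrite Z.sub_diag; reflexivity|].
    assert (Ht := turn_mod (L i 0) (L (S i) 0)).
    Z.to_euclidean_division_equations; lia.
  - assert (Ht := turn_mod (L i j) (L i (S j))). Z.to_euclidean_division_equations; lia.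
Qed.

Lemma lift_opposite i j i' j' :
  opposite (L i j) (L i' j') -> (lift i' j' - lift i j) mod 4 = 2.
Proof.
  unfold opposite; intros Hopp. assert (Hmod := lift_mod i j). assert (Hmod' := lift_mod i' j').
  Z.to_euclidean_division_equations; lia.
Qed.

Hypothesis no_opposite : forall i j di dj,
  (di <= 1)%nat -> (dj <= 1)%nat -> (i + di <= n)%nat -> (j + dj <= n)%nat ->
  ~ opposite (L i j) (L (i + di) (j + dj)).

Lemma no_opposite_right i j : (i < n)%nat -> (j <= n)%nat -> ~ opposite (L i j) (L (S i) j).
Proof.
  intros Hi Hj; assert (Hopp := no_opposite i j 1 0).
  rewrite Nat.add_1_r, Nat.add_0_r in Hopp; apply Hopp; lia.
Qed.

Lemma no_opposite_up i j : (i <= n)%nat -> (j < n)%nat -> ~ opposite (L i j) (L i (S j)).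
Proof.
  intros Hi Hj; assert (Hopp := no_opposite i j 0 1).
  rewrite Nat.add_1_r, Nat.add_0_r in Hopp; apply Hopp; lia.
Qed.

(* The two paths around a grid cell both turn by as much as its diagonal. *)
Lemma lift_right i j :
  (i < n)%nat -> (j <= n)%nat -> lift (S i) j = lift i j + turn (L i j) (L (S i) j).
Proof.
  induction j as [|j IHj]; intros Hi Hj; cbn [lift]; [reflexivity|].
  assert (Hdiag := no_opposite i j 1 1). rewrite !Nat.add_1_r in Hdiag.
  assert (Hlower := turn_triangle (L i j) (L (S i) j) (L (S i) (S j))
    (no_opposite_right i j Hi ltac:(lia)) (no_opposite_up (S i) j Hi Hj)
    (Hdiag ltac:(lia) ltac:(lia) Hi Hj)).
  assert (Hupper := turn_triangle (L i j) (L i (S j)) (L (S i) (S j))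
    (no_opposite_up i j ltac:(lia) Hj) (no_opposite_right i (S j) Hi Hj)
    (Hdiag ltac:(lia) ltac:(lia) Hi Hj)).
  rewrite IHj by lia; lia.
Qed.

Lemma lift_right_bound i j :
  (i < n)%nat -> (j <= n)%nat -> -1 <= lift (S i) j - lift i j <= 1.
Proof.
  intros Hi Hj; rewrite lift_right by assumption.
  assert (Ht := turn_bound _ _ (no_opposite_right i j Hi Hj)); lia.
Qed.

Lemma lift_up_bound i j : (i <= n)%nat -> (j < n)%nat -> -1 <= lift i (S j) - lift i j <= 1.
Proof.
  intros Hi Hj; cbn [lift]. assert (Ht := turn_bound _ _ (no_opposite_up i j Hi Hj)); lia.
Qed.

End GridLift.

Lemma opposite_paths_parallel (a b : nat -> Z) n :
  (forall i, (i < n)%nat -> -1 <= a (S i) - a i <= 1) ->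
  (forall i, (i < n)%nat -> -1 <= b (S i) - b i <= 1) ->
  (forall i, (i <= n)%nat -> (b i - a i) mod 4 = 2) -> b n - a n = b 0%nat - a 0%nat.
Proof.
  intros Ha Hb Hopp.
  enough (Hconst : forall i, (i <= n)%nat -> b i - a i = b 0%nat - a 0%nat) by (apply Hconst; lia).
  induction i as [|i IHi]; intros Hi; [reflexivity|].
  specialize (IHi ltac:(lia)); specialize (Ha i Hi); specialize (Hb i Hi).
  assert (Hopp_i := Hopp i ltac:(lia)); assert (Hopp_S := Hopp (S i) Hi).
  Z.to_euclidean_division_equations; lia.
Qed.

Lemma antipodal_grid_opposite_neighbours (n : nat) (L : nat -> nat -> Z) :
  (forall i, (i <= n)%nat -> opposite (L i 0%nat) (L (n - i)%nat n)) ->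
  (forall j, (j <= n)%nat -> opposite (L n j) (L 0%nat (n - j)%nat)) ->
  exists i j di dj, (di <= 1 /\ dj <= 1 /\ i + di <= n /\ j + dj <= n)%nat /\
    opposite (L i j) (L (i + di)%nat (j + dj)%nat).
Proof.
  intros Hhor Hver; apply NNPP; intros Hnone.
  assert (Hno : forall i j di dj, (di <= 1)%nat -> (dj <= 1)%nat -> (i + di <= n)%nat ->
    (j + dj <= n)%nat -> ~ opposite (L i j) (L (i + di)%nat (j + dj)%nat))
    by (intros i j di dj Hdi Hdj Hi Hj Hopp; apply Hnone; exists i, j, di, dj; auto).
  assert (Eh := opposite_paths_parallel (fun i => lift L i 0) (fun i => lift L (n - i) n) n).
  assert (Ev := opposite_paths_parallel (fun j => lift L n j) (fun j => lift L 0 (n - j)) n).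
  cbv beta in Eh, Ev; rewrite Nat.sub_diag, Nat.sub_0_r in Eh, Ev.
  assert (Hcorner := lift_opposite L _ _ _ _ (Hhor 0%nat ltac:(lia))).
  rewrite Nat.sub_0_r in Hcorner.
  enough (lift L n n - lift L 0 0 = 0)
    by (Z.to_euclidean_division_equations; lia).
  enough (lift L 0 n - lift L n 0 = lift L n n - lift L 0 0 /\
          lift L 0 0 - lift L n n = lift L 0 n - lift L n 0) by lia.
  split; [apply Eh|apply Ev]; intros i Hi.
  - apply (lift_right_bound n L Hno); lia.
  - assert (Hstep := lift_right_bound n L Hno (n - S i) n ltac:(lia) ltac:(lia)).
    replace (S (n - S i)) with (n - i)%nat in Hstep by lia; lia.
  - apply lift_opposite, Hhor, Hi.
  - apply (lift_up_bound n L Hno); lia.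
  - assert (Hstep := lift_up_bound n L Hno 0 (n - S i) ltac:(lia) ltac:(lia)).
    replace (S (n - S i)) with (n - i)%nat in Hstep by lia; lia.
  - apply lift_opposite, Hver, Hi.
Qed.

End AntipodalGrid.

Definition sector (x y : R) : Z :=
  if Rlt_dec 0 x then (if Rle_dec 0 y then 0 else 3)
  else if Rlt_dec 0 y then 1 else if Rlt_dec x 0 then 2 else 3.

Lemma sector_opp x y :
  x <> 0 \/ y <> 0 -> opposite (sector x y) (sector (- x) (- y)).
Proof.
  intros Hxy; unfold opposite, sector.
  repeat first [destruct (Rlt_dec _ _) | destruct (Rle_dec _ _)];
    first [reflexivity | exfalso; destruct Hxy; lra].
Qed.

Lemma opposite_sectors_far x y x' y' :
  opposite (sector x y) (sector x' y') -> Rabs x <= Rabs (x - x') /\ Rabs y <= Rabs (y - y').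
Proof.
  unfold opposite, sector.
  repeat first [destruct (Rlt_dec _ _) | destruct (Rle_dec _ _)];
    try discriminate; intros _; unfold Rabs; repeat destruct (Rcase_abs _); lra.
Qed.

(** * Maps of the square to the plane *)

Definition square : space := fun z => in_Rd 2 z /\ forall i, Rabs (z i) <= 1.

Definition sup_norm (z : nat -> R) : R := Rmax (Rabs (z 0%nat)) (Rabs (z 1%nat)).

Definition pt2 (s t : R) : nat -> R :=
  fun i => match i with O => s | 1%nat => t | _ => 0 end.

Definition origin : nat -> R := fun _ => 0.

Definition scale (t : R) (z : nat -> R) : nat -> R := fun i => t * z i.

Lemma pt2_in s t : in_Rd 2 (pt2 s t).
Proof. intros [|[|i]] Hi; try lia; reflexivity. Qed.

Lemma pt2_square s t : Rabs s <= 1 -> Rabs t <= 1 -> square (pt2 s t).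
Proof.
  intros Hs Ht; split; [apply pt2_in|].
  intros [|[|i]]; simpl; auto. rewrite Rabs_R0; lra.
Qed.

Lemma scale_pt2 c s t : scale c (pt2 s t) = pt2 (c * s) (c * t).
Proof.
  apply functional_extensionality; intros [|[|i]]; try reflexivity; apply Rmult_0_r.
Qed.

Lemma square_compact : seq_compact 2 square.
Proof.
  apply (closed_bounded_compact 2 square 1).
  - intros x Hx; apply Hx.
  - intros x i Hx _; apply Hx.
  - intros l Hin Hl; split; [exact Hin|]; intros i.
    destruct (Nat.lt_ge_cases i 2) as [Hi|Hi]; [|rewrite Hin, Rabs_R0 by exact Hi; lra].
    apply (adherent_le 2 square (fun x => Rabs (x i))); auto.
    + continuity_real.
    + intros x Hx; apply Hx.
Qed.

Lemma scale_square t z : Rabs t <= 1 -> square z -> square (scale t z).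
Proof.
  intros Ht [Hin Hz]; split; intros i; unfold scale.
  - intros Hi; rewrite Hin by exact Hi; ring.
  - rewrite Rabs_mult; specialize (Hz i). assert (0 <= Rabs (z i)) by apply Rabs_pos. nra.
Qed.

Lemma scale_0 z : scale 0 z = origin.
Proof. apply functional_extensionality; intros i; apply Rmult_0_l. Qed.

Lemma scale_origin t : scale t origin = origin.
Proof. apply functional_extensionality; intros i; apply Rmult_0_r. Qed.

Lemma scale_scale s t z : scale s (scale t z) = scale (s * t) z.
Proof. apply functional_extensionality; intros i; unfold scale; ring. Qed.

Lemma scale_1 z : scale 1 z = z.
Proof. apply functional_extensionality; intros i; apply Rmult_1_l. Qed.

Lemma scale_injective t z w : t <> 0 -> scale t z = scale t w -> z = w.
Proof.
  intros Ht Hzw; apply functional_extensionality; intros i.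
  apply (Rmult_eq_reg_l t); [exact (f_equal (fun x => x i) Hzw)|exact Ht].
Qed.

Lemma scale_fixed t z : t <> 1 -> scale t z = z -> z = origin.
Proof.
  intros Ht Hz; apply functional_extensionality; intros i.
  assert (Hi : t * z i = z i) by exact (f_equal (fun x => x i) Hz).
  apply (Rmult_eq_reg_l (1 - t)); unfold origin; lra.
Qed.

Lemma scale_continuous t d A : continuous_on d d A (scale t).
Proof. apply continuous_on_coords; intros i Hi; unfold scale; continuity_real. Qed.

Lemma origin_square : square origin.
Proof. split; [intros i _; reflexivity|]. intros i; unfold origin; rewrite Rabs_R0; lra. Qed.

Lemma coord_le_sup_norm z i : (i < 2)%nat -> Rabs (z i) <= sup_norm z.
Proof.
  revert i; apply (forall_lt_2 (fun i => Rabs (z i) <= sup_norm z)); [apply Rmax_l|apply Rmax_r].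
Qed.

Lemma sup_norm_attained z : exists i, (i < 2)%nat /\ sup_norm z = Rabs (z i).
Proof. unfold sup_norm, Rmax; destruct (Rle_dec _ _); [exists 1%nat|exists 0%nat]; auto. Qed.

Lemma sup_norm_square z : square z -> sup_norm z <= 1.
Proof. intros [_ Hz]; apply Rmax_lub; apply Hz. Qed.

Lemma sup_norm_origin : sup_norm origin = 0.
Proof. unfold sup_norm, origin; rewrite Rabs_R0; apply Rmax_left, Rle_refl. Qed.

Lemma sup_norm_opp z : sup_norm (scale (-1) z) = sup_norm z.
Proof. unfold sup_norm, scale; rewrite !Rabs_mult, Rabs_m1, !Rmult_1_l; reflexivity. Qed.

Lemma continuous_real_sup_norm A : continuous_real 2 A sup_norm.
Proof. unfold sup_norm; continuity_real. Qed.

Definition grid (n i : nat) : R := 2 * INR i / INR n - 1.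

Lemma grid_bound n i : (0 < n)%nat -> (i <= n)%nat -> Rabs (grid n i) <= 1.
Proof.
  intros Hn Hi; apply lt_0_INR in Hn; apply le_INR in Hi; assert (0 <= INR i) by apply pos_INR.
  assert (0 <= INR i / INR n <= 1).
  { split; [apply Rdiv_le_0_compat|apply (Rdiv_le_1 (INR i))]; assumption. }
  apply Rabs_le_between; unfold grid, Rdiv in *; lra.
Qed.

Lemma grid_rev n i : (0 < n)%nat -> (i <= n)%nat -> grid n (n - i) = -1 * grid n i.
Proof.
  intros Hn Hi; apply lt_0_INR in Hn; unfold grid; rewrite minus_INR by exact Hi; field; lra.
Qed.

Lemma grid_first n : grid n 0 = -1.
Proof. unfold grid, Rdiv; simpl; ring. Qed.

Lemma grid_last n : (0 < n)%nat -> grid n n = 1.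
Proof. intros Hn; apply lt_0_INR in Hn; unfold grid; field; lra. Qed.

Lemma grid_step n i di :
  (0 < n)%nat -> (di <= 1)%nat -> Rabs (grid n (i + di) - grid n i) <= 2 / INR n.
Proof.
  intros Hn Hdi; apply lt_0_INR in Hn.
  replace (grid n (i + di) - grid n i) with (INR di * (2 / INR n))
    by (unfold grid; rewrite plus_INR; field; lra).
  apply le_INR in Hdi; simpl in Hdi; assert (0 <= INR di) by apply pos_INR.
  assert (0 < 2 / INR n) by (apply Rdiv_lt_0_compat; lra).
  apply Rabs_le_between; nra.
Qed.

Definition close_pair_far_images (F : (nat -> R) -> (nat -> R)) (e : R) (z w : nat -> R) : Prop :=
  forall i, (i < 2)%nat -> Rabs (w i - z i) <= e /\ Rabs (F z i) <= Rabs (F z i - F w i).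

Lemma odd_map_close_pair (F : (nat -> R) -> (nat -> R)) (n : nat) :
  (forall z, square z -> sup_norm z = 1 ->
     forall i, (i < 2)%nat -> F (scale (-1) z) i = - F z i) ->
  (forall z, square z -> F z 0%nat <> 0 \/ F z 1%nat <> 0) -> (0 < n)%nat ->
  exists z w, square z /\ square w /\ close_pair_far_images F (2 / INR n) z w.
Proof.
  intros Hodd Hnonzero Hn.
  set (x := grid n).
  assert (Hsq : forall i j, (i <= n)%nat -> (j <= n)%nat -> square (pt2 (x i) (x j)))
    by (intros; apply pt2_square; apply grid_bound; assumption).
  set (L := fun i j => sector (F (pt2 (x i) (x j)) 0%nat) (F (pt2 (x i) (x j)) 1%nat)).
  assert (Hanti : forall i j, (i <= n)%nat -> (j <= n)%nat ->
    sup_norm (pt2 (x i) (x j)) = 1 -> opposite (L i j) (L (n - i)%nat (n - j)%nat)).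
  { intros i j Hi Hj Hbd; unfold L, x; rewrite !grid_rev, <- scale_pt2 by assumption.
    rewrite !Hodd by (auto; apply Hsq; assumption).
    apply sector_opp, Hnonzero, Hsq; assumption. }
  destruct (antipodal_grid_opposite_neighbours n L) as (i & j & di & dj & Hij & Hdiff).
  - intros i Hi; rewrite <- (Nat.sub_0_r n) at 2; apply Hanti; [exact Hi|lia|].
    unfold sup_norm, x; simpl; rewrite grid_first, Rabs_m1.
    apply Rmax_right, grid_bound; assumption.
  - intros j Hj; rewrite <- (Nat.sub_diag n); apply Hanti; [lia|exact Hj|].
    unfold sup_norm, x; simpl; rewrite grid_last, Rabs_R1 by exact Hn.
    apply Rmax_left, grid_bound; assumption.
  - destruct (opposite_sectors_far _ _ _ _ Hdiff) as [Hfar0 Hfar1].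
    exists (pt2 (x i) (x j)), (pt2 (x (i + di)%nat) (x (j + dj)%nat)).
    split; [apply Hsq; lia|]; split; [apply Hsq; lia|].
    unfold close_pair_far_images.
    apply forall_lt_2; split; simpl; try apply grid_step; tauto.
Qed.

Lemma zero_of_close_pairs (F : (nat -> R) -> (nat -> R)) :
  continuous_on 2 2 square F ->
  (forall n, (0 < n)%nat -> exists z w, square z /\ square w /\
     close_pair_far_images F (2 / INR n) z w) ->
  exists z, square z /\ forall i, (i < 2)%nat -> F z i = 0.
Proof.
  intros Hcont Hpairs.
  destruct (compact_cluster 2 square (fun n z => exists w, square w /\
    close_pair_far_images F (2 / INR (S n)) z w) square_compact) as (l & Hl & Hcl).
  { intros n; destruct (Hpairs (S n)) as (z & w & Hz & Hw & Hzw); [lia|eauto]. }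
  exists l; split; [exact Hl|]; intros i Hi; apply NNPP; intros Hne.
  assert (He : 0 < Rabs (F l i) / 3) by (assert (Hpos := Rabs_pos_lt _ Hne); lra).
  assert (Hnear : near 2 square l (fun z => Rabs (F z i - F l i) < Rabs (F l i) / 3)).
  { apply (continuous_real_near 2 square (fun z => F z i)); auto.
    apply (proj1 (continuous_on_coords 2 2 square F) Hcont i Hi). }
  generalize Hnear; rewrite near_coords; intros (r & Hr & Hclose).
  destruct (inv_INR_lt (r / 4) ltac:(lra)) as [n0 Hn0].
  destruct (Hcl _ (filter_and _ _ Hnear (near_close_coords 2 square l (r / 2) ltac:(lra))) n0)
    as (m & z & Hm & _ & (w & Hw & Hzw) & Hzl & Hzr).
  assert (Hwl : Rabs (F w i - F l i) < Rabs (F l i) / 3).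
  { apply Hclose; [exact Hw|]; intros k Hk.
    specialize (Hn0 m Hm); rewrite <- S_INR in Hn0.
    destruct (Hzw k Hk) as [Hwz _]; unfold Rdiv in Hwz; specialize (Hzr k Hk).
    apply Rabs_lt_between in Hzr; apply Rabs_le_between in Hwz; apply Rabs_lt_between; lra. }
  destruct (Hzw i Hi) as [_ Hfar].
  revert Hfar Hzl Hwl He; unfold Rabs; repeat destruct (Rcase_abs _); lra.
Qed.

Theorem borsuk_square (F : (nat -> R) -> (nat -> R)) :
  continuous_on 2 2 square F ->
  (forall z, square z -> sup_norm z = 1 ->
     forall i, (i < 2)%nat -> F (scale (-1) z) i = - F z i) ->
  exists z, square z /\ forall i, (i < 2)%nat -> F z i = 0.
Proof.
  intros Hcont Hodd; apply NNPP; intros Hnone; apply Hnone.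
  apply zero_of_close_pairs; [exact Hcont|].
  intros n; apply odd_map_close_pair; [exact Hodd|]; intros z Hz.
  destruct (Req_dec (F z 0%nat) 0), (Req_dec (F z 1%nat) 0); auto.
  exfalso; apply Hnone; exists z; split; [exact Hz|]; apply forall_lt_2; assumption.
Qed.

Definition injective_on (A : space) (f : (nat -> R) -> (nat -> R)) : Prop :=
  forall x y, A x -> A y -> f x = f y -> x = y.

Section InvarianceOfDomain.

Variable F : (nat -> R) -> (nat -> R).
Hypothesis F_planar : forall z, square z -> in_Rd 2 (F z).
Hypothesis F_continuous : continuous_on 2 2 square F.
Hypothesis F_injective : injective_on square F.

Lemma injective_far_from_origin :
  exists e, 0 < e /\ forall z, square z -> 1 / 4 <= sup_norm z ->
    exists i, (i < 2)%nat /\ e <= Rabs (F z i - F origin i).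
Proof.
  assert (HF := proj1 (continuous_on_coords 2 2 square F) F_continuous).
  set (D := fun z => sup_norm (fun i => F z i - F origin i)).
  assert (HD : forall z i, (i < 2)%nat -> Rabs (F z i - F origin i) <= D z)
    by (intros z; apply (coord_le_sup_norm (fun i => F z i - F origin i))).
  destruct (compact_positive_lower_bound 2 square (fun z => D z + Rmax 0 (1 / 4 - sup_norm z)))
    as (e & He & Hlow).
  - exact square_compact.
  - apply continuous_real_plus; [unfold D, sup_norm; continuity_real; apply HF; lia|].
    continuity_real; apply continuous_real_sup_norm.
  - intros z Hz; specialize (HD z). assert (Hs := Rmax_l 0 (1 / 4 - sup_norm z)).
    assert (HD0 : 0 <= D z)
      by (eapply Rle_trans; [apply Rabs_pos|apply (HD 0%nat); lia]).
    apply Rnot_le_lt; intros Hle.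
    assert (Ez : z = origin).
    { apply F_injective; [exact Hz|apply origin_square|].
      apply (in_Rd_ext 2); [apply F_planar, Hz|apply F_planar, origin_square|].
      intros i Hi; apply Rminus_diag_uniq, Rabs_eq_0, Rle_antisym; [|apply Rabs_pos].
      specialize (HD i Hi); lra. }
    rewrite Ez, sup_norm_origin, Rmax_right in Hle by lra. rewrite Ez in HD0; lra.
  - exists e; split; [exact He|]; intros z Hz Hs; specialize (Hlow z Hz).
    rewrite Rmax_left, Rplus_0_r in Hlow by lra.
    destruct (sup_norm_attained (fun i => F z i - F origin i)) as (i & Hi & Ei).
    exists i; split; [exact Hi|]. rewrite <- Ei; exact Hlow.
Qed.

Definition reflected (z : nat -> R) : nat -> R := scale (- Rmax 0 (2 * sup_norm z - 1)) z.

Definition cutoff (z : nat -> R) : R := Rmax 0 (Rmin 1 (2 - 4 * sup_norm z)).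

(* Equal to [F z - F (- z)] on the boundary of the square and to [F z - c] on its core; in
   between it has no zero if [c] is close to [F 0]. *)
Definition odd_deformation (c z : nat -> R) : nat -> R :=
  fun i => F z i - F (reflected z) i - cutoff z * (c i - F origin i).

Lemma reflected_square z : square z -> square (reflected z).
Proof.
  intros Hz; apply scale_square; [|exact Hz].
  assert (Hs := sup_norm_square z Hz); rewrite Rabs_Ropp, Rabs_pos_eq by apply Rmax_l.
  apply Rmax_lub; lra.
Qed.

Lemma cutoff_range z : 0 <= cutoff z <= 1.
Proof. split; [apply Rmax_l|apply Rmax_lub; [lra|apply Rmin_l]]. Qed.

Lemma odd_deformation_continuous c : continuous_on 2 2 square (odd_deformation c).
Proof.
  apply continuous_on_coords; intros i Hi; unfold odd_deformation.
  assert (HFi := proj1 (continuous_on_coords 2 2 square F) F_continuous i Hi).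
  apply continuous_real_minus; [apply continuous_real_minus; [exact HFi|]|].
  - apply (continuous_real_comp_map 2 2 square square reflected (fun y => F y i)); auto;
      [exact reflected_square|].
    apply continuous_on_coords; intros k Hk; unfold reflected, scale.
    continuity_real; apply continuous_real_sup_norm.
  - unfold cutoff; continuity_real; apply continuous_real_sup_norm.
Qed.

Lemma odd_deformation_odd c z i :
  sup_norm z = 1 -> odd_deformation c (scale (-1) z) i = - odd_deformation c z i.
Proof.
  intros Hbd; unfold odd_deformation, cutoff, reflected. rewrite sup_norm_opp, Hbd.
  rewrite (Rmax_right 0 (2 * 1 - 1)), (Rmin_right 1), (Rmax_left 0 (2 - 4 * 1)) by lra.
  rewrite scale_scale. replace (- (2 * 1 - 1)) with (-1) by ring.
  replace (-1 * -1) with 1 by ring. rewrite scale_1; ring.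
Qed.

Lemma odd_deformation_zero_inner c z :
  square z -> (forall i, (i < 2)%nat -> odd_deformation c z i = 0) -> sup_norm z < 1 / 2.
Proof.
  intros Hz Hzero; apply Rnot_le_lt; intros Houter.
  assert (Hz0 : z = origin).
  { apply (scale_fixed (- Rmax 0 (2 * sup_norm z - 1)));
      [assert (Hpos := Rmax_l 0 (2 * sup_norm z - 1)); lra|].
    apply F_injective; [apply reflected_square, Hz|exact Hz|].
    apply (in_Rd_ext 2); [apply F_planar, reflected_square, Hz|apply F_planar, Hz|].
    intros i Hi; specialize (Hzero i Hi); unfold odd_deformation, cutoff in Hzero.
    rewrite Rmin_right, Rmax_left in Hzero by lra. unfold reflected in Hzero; lra. }
  rewrite Hz0, sup_norm_origin in Houter; lra.
Qed.

Theorem invariance_of_domain_square :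
  near 2 (in_Rd 2) (F origin) (fun c => exists z, square z /\ F z = c).
Proof.
  destruct injective_far_from_origin as (e & He & Hfar).
  apply near_coords; exists e; split; [exact He|]; intros c Hcin Hc.
  destruct (borsuk_square (odd_deformation c)) as (z & Hz & Hzero).
  - apply odd_deformation_continuous.
  - intros z _ Hbd i _; apply odd_deformation_odd, Hbd.
  - exists z; split; [exact Hz|]. apply (in_Rd_ext 2); [apply F_planar, Hz|exact Hcin|].
    assert (Hinner := odd_deformation_zero_inner c z Hz Hzero).
    unfold odd_deformation, reflected in Hzero.
    rewrite Rmax_left, Ropp_0, scale_0 in Hzero by lra.
    destruct (Rle_dec (sup_norm z) (1 / 4)) as [Hcore|Hring].
    + unfold cutoff in Hzero; rewrite Rmin_left, Rmax_right in Hzero by lra.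
      intros i Hi; specialize (Hzero i Hi); lra.
    + exfalso; destruct (Hfar z Hz ltac:(lra)) as (i & Hi & Hei).
      specialize (Hzero i Hi); specialize (Hc i Hi). assert (Hcut := cutoff_range z).
      replace (F z i - F origin i) with (cutoff z * (c i - F origin i)) in Hei by lra.
      rewrite Rabs_mult, (Rabs_pos_eq (cutoff z)) in Hei by tauto.
      assert (Hcp := Rabs_pos (c i - F origin i)). nra.
Qed.

End InvarianceOfDomain.

(** * Discs in surfaces *)

Lemma surface_disc d A p e :
  is_surface d A -> A p -> 0 < e ->
  exists E, continuous_on 2 d square E /\ injective_on square E /\ E origin = p /\
    forall z, square z -> A (E z) /\ forall i, (i < d)%nat -> Rabs (E z i - p i) < e.
Proof.
  intros [_ HA] Hp He.
  destruct (HA p Hp) as (U & V & HUp & [HUA _] & HV & f & g & HfV & HgU & Hgf & Hfg & _ & Hgc).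
  set (q := f p). assert (HVq : V q) by (apply HfV, HUp).
  assert (Hnear : near 2 (in_Rd 2) q (fun y => V y /\
    forall i, (i < d)%nat -> Rabs (g y i - p i) < e)).
  { apply filter_and; [apply rel_open_near; assumption|].
    apply (near_subspace 2 _ V); [apply rel_open_near; assumption|].
    replace p with (g q) by (apply Hgf, HUp).
    apply (continuous_on_near 2 d V U g q
      (fun x => forall i, (i < d)%nat -> Rabs (x i - g q i) < e)); auto.
    apply near_close_coords, He. }
  apply near_coords in Hnear; destruct Hnear as (r & Hr & Hball).
  set (emb := fun (z : nat -> R) i => q i + r / 2 * z i).
  assert (Hemb : forall z, square z ->
    V (emb z) /\ forall i, (i < d)%nat -> Rabs (g (emb z) i - p i) < e).
  { intros z [Hin Hz]; apply Hball; unfold emb.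
    - intros i Hi. rewrite (proj1 HV q HVq i Hi), (Hin i Hi); ring.
    - intros i _; replace (q i + r / 2 * z i - q i) with (r / 2 * z i) by ring.
      rewrite Rabs_mult, (Rabs_pos_eq (r / 2)) by lra. specialize (Hz i); nra. }
  exists (fun z => g (emb z)); split; [|split; [|split]].
  - apply (continuous_on_comp 2 2 d square V emb g); auto; [intros z Hz; apply Hemb, Hz|].
    apply continuous_on_coords; intros i Hi; unfold emb; continuity_real.
  - intros z w Hz Hw Ezw.
    assert (Eqzw : emb z = emb w).
    { rewrite <- (Hfg (emb z)), Ezw by (apply Hemb, Hz); apply Hfg, Hemb, Hw. }
    apply functional_extensionality; intros i.
    assert (Ei := f_equal (fun x => x i) Eqzw); unfold emb in Ei.
    apply (Rmult_eq_reg_l (r / 2)); lra.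
  - rewrite <- (Hgf p HUp); f_equal.
    apply functional_extensionality; intros i; unfold emb, q, origin; ring.
  - intros z Hz; split; [apply HUA, HgU, Hemb, Hz|apply Hemb, Hz].
Qed.

Lemma shrink_disc d A U E :
  continuous_on 2 d square E -> (forall z, square z -> A (E z)) ->
  near d A (E origin) U ->
  exists s, 0 < s <= 1 /\ forall z, square z -> U (E (scale s z)).
Proof.
  intros HEc HEA HU.
  assert (HnearU : near 2 square origin (fun z => U (E z)))
    by (apply (continuous_on_near 2 d square A E); auto; apply origin_square).
  apply near_coords in HnearU; destruct HnearU as (r & Hr & HrU).
  set (s := Rmin 1 (r / 2)).
  assert (Hs : 0 < s <= 1) by (split; [apply Rmin_glb_lt; lra|apply Rmin_l]).
  assert (Hsr : s <= r / 2) by apply Rmin_r.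
  exists s; split; [exact Hs|]; intros z Hz.
  apply HrU; [apply scale_square; [rewrite Rabs_pos_eq; lra|exact Hz]|]; intros i _.
  unfold scale, origin; rewrite Rminus_0_r, Rabs_mult, (Rabs_pos_eq s) by lra.
  assert (Hzi := proj2 Hz i). nra.
Qed.

Lemma invariance_of_domain_surface d A E :
  is_surface d A -> (forall z, square z -> A (E z)) -> continuous_on 2 d square E ->
  injective_on square E ->
  near d A (E origin) (fun x => exists z, square z /\ E z = x).
Proof.
  intros [_ HA] HEA HEc HEinj.
  set (p := E origin). assert (Hp : A p) by apply HEA, origin_square.
  destruct (HA p Hp) as (U & V & HUp & HU & [HVin _] & f & g & HfV & HgU & Hgf & Hfg & Hfc & _).
  assert (HnearU := rel_open_near d A U p HU HUp).
  destruct (shrink_disc d A U E HEc HEA HnearU) as (s & Hs & HsU).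
  assert (Hsq : forall z, square z -> square (scale s z))
    by (intros z; apply scale_square; rewrite Rabs_pos_eq; lra).
  assert (Hopen : near 2 (in_Rd 2) (f p) (fun c => exists z, square z /\ f (E (scale s z)) = c)).
  { unfold p; rewrite <- (scale_origin s) at 1.
    apply (invariance_of_domain_square (fun z => f (E (scale s z)))); auto.
    - apply (continuous_on_comp 2 d 2 square U (fun z => E (scale s z)) f); auto.
      apply (continuous_on_comp 2 2 d square square (scale s) E); auto.
      apply scale_continuous.
    - intros z w Hz Hw Hfzw. apply (scale_injective s); [lra|]. apply HEinj; auto.
      rewrite <- (Hgf (E (scale s z))), Hfzw; auto. }
  apply (near_subspace d A U); [exact HnearU|].
  assert (Hpre := continuous_on_near d 2 U (in_Rd 2) f p _ (fun x Hx => HVin _ (HfV x Hx))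
    Hfc HUp Hopen).
  generalize (filter_and _ _ (near_in d U p) Hpre); apply filter_imp.
  intros x [HUx (z & Hz & Hfz)]; exists (scale s z); split; [auto|].
  rewrite <- (Hgf x HUx), <- Hfz; symmetry; auto.
Qed.

(** * Faces of the realization *)

Definition face (d : nat) (s : list nat) : space :=
  fun x => in_Rd d x /\ (forall i, 0 <= x i) /\ rsum d x = 1 /\ forall i, x i <> 0 -> In i s.

Definition bary (a b c : nat) (u v w : R) : nat -> R :=
  fun i => u * kronecker a i + v * kronecker b i + w * kronecker c i.

Lemma bary_face d a b c u v w :
  (a < d)%nat -> (b < d)%nat -> (c < d)%nat ->
  0 <= u -> 0 <= v -> 0 <= w -> u + v + w = 1 -> face d [a; b; c] (bary a b c u v w).
Proof.
  intros Ha Hb Hc Hu Hv Hw Hs; unfold bary; repeat split.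
  - intros i Hi; rewrite !kronecker_diff by lia; ring.
  - intros i; unfold kronecker; destruct (Nat.eqb i a), (Nat.eqb i b), (Nat.eqb i c); lra.
  - rewrite !rsum_plus, !rsum_scal, !rsum_kronecker; auto; lra.
  - intros i Hi; apply NNPP; intros Hout; apply Hi; simpl in Hout.
    rewrite !kronecker_diff by (intros ->; tauto); ring.
Qed.

Lemma face_bary d a b c x :
  a <> b -> a <> c -> b <> c -> face d [a; b; c] x -> x = bary a b c (x a) (x b) (x c).
Proof.
  intros Hab Hac Hbc (_ & _ & _ & Hsup); apply functional_extensionality; intros i.
  unfold bary, kronecker.
  destruct (Nat.eqb_spec i a), (Nat.eqb_spec i b), (Nat.eqb_spec i c);
    try congruence; try (subst i; lra).
  destruct (Req_dec (x i) 0) as [->|Hx]; [lra|].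
  destruct (Hsup i Hx) as [|[|[|[]]]]; congruence.
Qed.

Lemma face_sum d a b c x :
  (a < d)%nat -> (b < d)%nat -> (c < d)%nat ->
  a <> b -> a <> c -> b <> c -> face d [a; b; c] x -> x a + x b + x c = 1.
Proof.
  intros Ha Hb Hc Hab Hac Hbc Hx.
  assert (Ex := face_bary d a b c x Hab Hac Hbc Hx).
  destruct Hx as (_ & _ & Hs & _). rewrite Ex in Hs. unfold bary in Hs.
  rewrite !rsum_plus, !rsum_scal, !rsum_kronecker in Hs; auto; lra.
Qed.

Lemma realization_face N n1 n2 n3 x :
  realization N n1 n2 n3 x <-> exists s, simplex_C N n1 n2 n3 s /\ face N s x.
Proof.
  split.
  - intros (Hin & Hpos & Hsum & s & Hs & Hsup); exists s; repeat split; auto.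
    intros i Hi; apply Hsup; [|exact Hi]. apply Nat.nle_gt; intros HiN; apply Hi, Hin, HiN.
  - intros (s & Hs & Hin & Hpos & Hsum & Hsup); repeat split; auto; exists s; auto.
Qed.

Lemma face_incl d s t x : incl s t -> face d s x -> face d t x.
Proof. intros Hst (Hin & Hpos & Hsum & Hsup); repeat split; auto. Qed.

Lemma face_in_realization N n1 n2 n3 s t x :
  simplex_C N n1 n2 n3 t -> incl s t -> face N s x -> realization N n1 n2 n3 x.
Proof.
  intros Ht Hst Hx; apply realization_face; exists t; split; [exact Ht|].
  apply (face_incl N s t x Hst Hx).
Qed.

Lemma realization_star N n1 n2 n3 a b t x :
  (forall s, simplex_C N n1 n2 n3 s -> In a s -> In b s -> incl s t) ->
  realization N n1 n2 n3 x -> 0 < x a -> 0 < x b -> face N t x.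
Proof.
  intros Hstar Hx Hxa Hxb; apply realization_face in Hx; destruct Hx as (s & Hs & Hx).
  assert (Hsup : forall i, x i <> 0 -> In i s) by apply Hx.
  apply (face_incl N s t x); [|exact Hx].
  apply Hstar; [exact Hs|apply Hsup; lra|apply Hsup; lra].
Qed.

Lemma realization_compact N n1 n2 n3 : seq_compact N (realization N n1 n2 n3).
Proof.
  apply (closed_bounded_compact N _ 1).
  - intros x Hx; apply Hx.
  - intros x i (_ & Hpos & Hsum & _) Hi. rewrite Rabs_pos_eq, <- Hsum by apply Hpos.
    apply rsum_term_le; auto.
  - intros l Hin Hl; split; [exact Hin|]; split; [|split].
    + intros i. destruct (Nat.lt_ge_cases i N) as [Hi|Hi]; [|rewrite Hin by exact Hi; lra].
      apply (adherent_ge N _ (fun x => x i) l 0 (continuous_real_coord N _ i Hi)) in Hl; auto.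
      intros x Hx; apply Hx.
    + apply (adherent_eq N (realization N n1 n2 n3) (rsum N)); auto; [|intros x Hx; apply Hx].
      apply (continuous_real_rsum N _ N (fun i x => x i)).
      intros i Hi; apply continuous_real_coord, Hi.
    + destruct (Hl (fun y => forall i, (i < N)%nat -> l i <> 0 -> y i <> 0))
        as (y & (_ & _ & _ & s & Hs & Hsup) & Hy).
      * apply (filter_forall_lt _ N (fun i y => l i <> 0 -> y i <> 0)); intros i Hi.
        destruct (Req_dec (l i) 0) as [E0|Hli]; [apply filter_forall; tauto|].
        generalize (continuous_real_near N _ (fun y => y i) l _
          (continuous_real_coord N (fun _ => True) i Hi) I (Rabs_pos_lt _ Hli)).
        apply filter_imp; intros y Hy _ Ey.
        rewrite Ey, Rminus_0_l, Rabs_Ropp in Hy; lra.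
      * exists s; split; auto.
Qed.

Lemma triangle_up N n1 n2 n3 k :
  (k < N)%nat -> simplex_C N n1 n2 n3 [k; (k + n1) mod N; (k + n1 + n2) mod N]%nat.
Proof. intros Hk; right; right; exists k; auto. Qed.

Lemma triangle_down N n1 n2 n3 k :
  (k < N)%nat ->
  simplex_C N n1 n2 n3 [k; (k + (N - n1)) mod N; (k + (N - n1) + (N - n2)) mod N]%nat.
Proof. intros Hk; right; right; exists k; auto. Qed.

(** * Edges whose star is not a disc *)

Definition midpoint (a b : nat) : nat -> R := fun i => (kronecker a i + kronecker b i) / 2.

Lemma midpoint_bary a b c : midpoint a b = bary a b c (1 / 2) (1 / 2) 0.
Proof. apply functional_extensionality; intros i; unfold midpoint, bary; field. Qed.

Lemma midpoint_left a b : a <> b -> midpoint a b a = 1 / 2.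
Proof. intros Hab; unfold midpoint; rewrite kronecker_same, kronecker_diff by exact Hab; field. Qed.

Lemma midpoint_right a b : a <> b -> midpoint a b b = 1 / 2.
Proof. intros Hab; unfold midpoint; rewrite kronecker_same, kronecker_diff by auto; field. Qed.

Lemma midpoint_off a b i : i <> a -> i <> b -> midpoint a b i = 0.
Proof. intros Ha Hb; unfold midpoint; rewrite !kronecker_diff by assumption; field. Qed.

(* By invariance of domain, a disc centred on the edge [ab] would contain points beyond it. *)
Lemma triangle_disc_centre d a b c E :
  (a < d)%nat -> (b < d)%nat -> (c < d)%nat -> a <> b -> a <> c -> b <> c ->
  continuous_on 2 d square E -> injective_on square E ->
  (forall z, square z -> face d [a; b; c] (E z)) -> 0 < E origin c.
Proof.
  intros Ha Hb Hc Hab Hac Hbc HEc HEinj Hin.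
  assert (HEi := proj1 (continuous_on_coords 2 d square E) HEc).
  set (F := fun z => pt2 (E z a) (E z c)).
  assert (Hopen : near 2 (in_Rd 2) (F origin) (fun y => exists z, square z /\ F z = y)).
  { apply invariance_of_domain_square.
    - intros z _; apply pt2_in.
    - apply continuous_on_coords; apply forall_lt_2; simpl; apply HEi; assumption.
    - intros z w Hz Hw Ezw. apply HEinj; auto.
      assert (E0 := f_equal (fun y => y 0%nat) Ezw); simpl in E0.
      assert (E1 := f_equal (fun y => y 1%nat) Ezw); simpl in E1.
      assert (Sz := face_sum d a b c _ Ha Hb Hc Hab Hac Hbc (Hin z Hz)).
      assert (Sw := face_sum d a b c _ Ha Hb Hc Hab Hac Hbc (Hin w Hw)).
      rewrite (face_bary d a b c (E z)), (face_bary d a b c (E w)) by auto.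
      f_equal; lra. }
  destruct (proj1 (proj2 (Hin _ origin_square)) c) as [|Hc0]; [assumption|exfalso].
  apply near_coords in Hopen; destruct Hopen as (r & Hr & Hopen).
  destruct (Hopen (pt2 (E origin a) (- (r / 2)))) as (z & Hz & Ez).
  - apply pt2_in.
  - unfold F; rewrite <- Hc0; apply forall_lt_2; simpl; apply Rabs_lt_between; lra.
  - assert (E1 := f_equal (fun y => y 1%nat) Ez); simpl in E1.
    destruct (Hin z Hz) as (_ & Hpos & _). specialize (Hpos c); lra.
Qed.

Lemma free_edge_not_surface d (A : space) a b c :
  (a < d)%nat -> (b < d)%nat -> (c < d)%nat -> a <> b -> a <> c -> b <> c ->
  (forall x, face d [a; b; c] x -> A x) ->
  (forall x, A x -> 0 < x a -> 0 < x b -> face d [a; b; c] x) ->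
  ~ is_surface d A.
Proof.
  intros Ha Hb Hc Hab Hac Hbc Hface Hstar HA.
  assert (Hp : A (midpoint a b))
    by (rewrite (midpoint_bary a b c); apply Hface, bary_face; auto; lra).
  destruct (surface_disc d A _ (1 / 4) HA Hp ltac:(lra)) as (E & HEc & HEinj & HE0 & HE).
  assert (Hcentre : 0 < E origin c).
  { apply (triangle_disc_centre d a b); auto.
    intros z Hz; destruct (HE z Hz) as [HEA Hclose].
    assert (Hca := Hclose a Ha). assert (Hcb := Hclose b Hb).
    rewrite midpoint_left in Hca by exact Hab; rewrite midpoint_right in Hcb by exact Hab.
    apply Rabs_lt_between in Hca; apply Rabs_lt_between in Hcb.
    apply Hstar; [exact HEA|lra|lra]. }
  rewrite HE0, midpoint_off in Hcentre by auto; lra.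
Qed.

(* The disc formed by the triangles [abc] and [abd], folded along the edge [ab]. *)
Definition open_book (a b c d : nat) (z : nat -> R) : nat -> R := fun i =>
  (2 - Rabs (z 1%nat) + z 0%nat) / 4 * kronecker a i +
  (2 - Rabs (z 1%nat) - z 0%nat) / 4 * kronecker b i +
  Rmax 0 (z 1%nat) / 2 * kronecker c i + Rmax 0 (- z 1%nat) / 2 * kronecker d i.

Lemma open_book_continuous n a b c d : continuous_on 2 n square (open_book a b c d).
Proof.
  apply continuous_on_coords; intros i Hi; unfold open_book, Rdiv; continuity_real.
Qed.

Lemma open_book_origin a b c d : open_book a b c d origin = midpoint a b.
Proof.
  apply functional_extensionality; intros i; unfold open_book, midpoint, origin.
  rewrite Rabs_R0, Ropp_0, Rmax_left by lra; field.
Qed.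

Lemma open_book_faces n a b c d z :
  (a < n)%nat -> (b < n)%nat -> (c < n)%nat -> (d < n)%nat -> square z ->
  face n [a; b; c] (open_book a b c d z) \/ face n [a; b; d] (open_book a b c d z).
Proof.
  intros Ha Hb Hc Hd [_ Hz].
  assert (H0 := Hz 0%nat). assert (H1 := Hz 1%nat).
  apply Rabs_le_between in H0; apply Rabs_le_between in H1.
  destruct (Rle_dec 0 (z 1%nat)) as [Hs|Hs]; [left|right].
  - replace (open_book a b c d z) with
      (bary a b c ((2 - z 1%nat + z 0%nat) / 4) ((2 - z 1%nat - z 0%nat) / 4) (z 1%nat / 2)).
    + apply bary_face; auto; lra.
    + apply functional_extensionality; intros i; unfold open_book, bary.
      rewrite (Rmax_right 0), (Rmax_left 0), Rabs_pos_eq by lra; field.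
  - replace (open_book a b c d z) with
      (bary a b d ((2 + z 1%nat + z 0%nat) / 4) ((2 + z 1%nat - z 0%nat) / 4) (- z 1%nat / 2)).
    + apply bary_face; auto; lra.
    + apply functional_extensionality; intros i; unfold open_book, bary.
      rewrite (Rmax_left 0), (Rmax_right 0), Rabs_left by lra; field.
Qed.

Lemma open_book_injective a b c d :
  a <> b -> a <> c -> a <> d -> b <> c -> b <> d -> c <> d ->
  injective_on square (open_book a b c d).
Proof.
  intros Hab Hac Had Hbc Hbd Hcd z w [Hz _] [Hw _] Ezw.
  assert (Hcoord := fun i => f_equal (fun x => x i) Ezw).
  assert (Ea := Hcoord a). assert (Eb := Hcoord b).
  assert (Ec := Hcoord c). assert (Ed := Hcoord d).
  unfold open_book in Ea, Eb, Ec, Ed.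
  rewrite !kronecker_same, !kronecker_diff in Ea, Eb, Ec, Ed by auto.
  assert (E1 : z 1%nat = w 1%nat)
    by (revert Ec Ed; unfold Rmax; repeat destruct (Rle_dec _ _); lra).
  rewrite E1 in Ea, Eb.
  apply (in_Rd_ext 2); [exact Hz|exact Hw|]; apply forall_lt_2; lra.
Qed.

(* The disc formed by two of the pages would be a neighbourhood of the midpoint of the edge,
   which the third page approaches. *)
Lemma three_pages_not_surface n (A : space) a b c d e :
  (a < n)%nat -> (b < n)%nat -> (c < n)%nat -> (d < n)%nat -> (e < n)%nat ->
  NoDup [a; b; c; d; e] ->
  (forall x, face n [a; b; c] x -> A x) ->
  (forall x, face n [a; b; d] x -> A x) ->
  (forall x, face n [a; b; e] x -> A x) ->
  ~ is_surface n A.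
Proof.
  intros Ha Hb Hc Hd He Hnodup Hfc Hfd Hfe HA.
  repeat match goal with H : NoDup (_ :: _) |- _ => inversion H; clear H; subst end.
  simpl in *.
  assert (Hbook : near n A (midpoint a b) (fun x => exists z, square z /\ open_book a b c d z = x)).
  { rewrite <- (open_book_origin a b c d). apply invariance_of_domain_surface; auto.
    - intros z Hz; destruct (open_book_faces n a b c d z); auto.
    - apply open_book_continuous.
    - apply open_book_injective; intuition. }
  apply near_coords in Hbook; destruct Hbook as (r & Hr & Hbook).
  set (t := Rmin 1 (r / 2)).
  assert (Ht : 0 < t <= 1) by (split; [apply Rmin_glb_lt; lra|apply Rmin_l]).
  assert (Htr : t <= r / 2) by apply Rmin_r.
  destruct (Hbook (bary a b e ((1 - t) / 2) ((1 - t) / 2) t)) as (z & _ & Ez).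
  - apply Hfe, bary_face; auto; lra.
  - intros i _; rewrite (midpoint_bary a b e); unfold bary, kronecker.
    apply Rabs_lt_between.
    destruct (Nat.eqb_spec i a), (Nat.eqb_spec i b), (Nat.eqb_spec i e);
      try (exfalso; intuition congruence); lra.
  - assert (Ee := f_equal (fun x => x e) Ez); unfold open_book, bary in Ee.
    rewrite kronecker_same, !kronecker_diff in Ee by intuition. lra.
Qed.

(** * The degenerate complexes *)

Lemma mod_cases k N :
  (0 < N)%nat -> (k < 3 * N)%nat ->
  (k < N /\ k mod N = k)%nat \/ (N <= k < 2 * N /\ k mod N = k - N)%nat \/
  (2 * N <= k /\ k mod N = k - 2 * N)%nat.
Proof.
  intros HN Hk.
  destruct (Nat.lt_ge_cases k N); [left; split; [lia|apply Nat.mod_small; assumption]|].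
  destruct (Nat.lt_ge_cases k (2 * N)); right; [left|right]; split; try lia; symmetry.
  - apply (Nat.mod_unique k N 1); lia.
  - apply (Nat.mod_unique k N 2); lia.
Qed.

Ltac case_mod k N :=
  let m := fresh "m" in
  let E := fresh "E" in
  destruct (mod_cases k N ltac:(lia) ltac:(lia)) as [[? E]|[[? E]|[? E]]];
  try (exfalso; lia); set (m := Nat.modulo k N) in *; clearbody m.

Ltac case_mods N :=
  repeat match goal with
  | |- context [Nat.modulo ?k N] => case_mod k N
  | _ : context [Nat.modulo ?k N] |- _ => case_mod k N
  end.

Lemma equal_n1_n2_not_surface N n n3 :
  (1 <= n)%nat -> (n <= n3)%nat -> (n + n + n3)%nat = N -> n3 <> (2 * n)%nat ->
  ~ is_surface N (realization N n n n3).
Proof.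
  intros Hn Hn3 HN Hne.
  apply (free_edge_not_surface N _ 0 (2 * n) n); try lia.
  - intros x; apply (face_in_realization _ _ _ _ _ _ _ (triangle_up N n n n3 0 ltac:(lia))).
    rewrite !Nat.mod_small by lia; intros i; simpl; lia.
  - intros x; apply realization_star.
    intros s [(k & Hk & ->)|[(k & j & Hk & Hj & ->)|(k & Hk & [-> | ->])]];
      unfold incl; case_mods N; simpl; intros; lia.
Qed.

Lemma equal_n2_n3_not_surface N n1 n :
  (1 <= n1)%nat -> (n1 < n)%nat -> (n1 + n + n)%nat = N ->
  ~ is_surface N (realization N n1 n n).
Proof.
  intros Hn1 Hn HN.
  apply (free_edge_not_surface N _ 0 n1 (n1 + n)); try lia.
  - intros x; apply (face_in_realization _ _ _ _ _ _ _ (triangle_up N n1 n n 0 ltac:(lia))).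
    rewrite !Nat.mod_small by lia; intros i; simpl; lia.
  - intros x; apply realization_star.
    intros s [(k & Hk & ->)|[(k & j & Hk & Hj & ->)|(k & Hk & [-> | ->])]];
      unfold incl; case_mods N; simpl; intros; lia.
Qed.

Lemma n3_eq_n1_plus_n2_not_surface N n1 n2 n3 :
  (1 <= n1)%nat -> (n1 < n2)%nat -> n3 = (n1 + n2)%nat -> (n1 + n2 + n3)%nat = N ->
  ~ is_surface N (realization N n1 n2 n3).
Proof.
  intros Hn1 Hn2 Hn3 HN.
  apply (three_pages_not_surface N _ 0 n3 n1 n2 (n3 + n1)); try lia.
  - repeat constructor; simpl; lia.
  - intros x; apply (face_in_realization _ _ _ _ _ _ _ (triangle_up N n1 n2 n3 0 ltac:(lia))).
    rewrite !Nat.mod_small by lia; intros i; simpl; lia.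
  - intros x; apply (face_in_realization _ _ _ _ _ _ _ (triangle_down N n1 n2 n3 n3 ltac:(lia))).
    intros i; case_mods N; simpl; lia.
  - intros x; apply (face_in_realization _ _ _ _ _ _ _ (triangle_up N n1 n2 n3 n3 ltac:(lia))).
    intros i; case_mods N; simpl; lia.
Qed.

(** * The tetrahedral complexes *)

(* The vertices (1,1,1), (1,-1,-1), (-1,1,-1), (-1,-1,1) of a regular tetrahedron. *)
Definition tetra_vertex (m k : nat) : R := if (Nat.eqb m 0 || Nat.eqb m (S k))%bool then 1 else -1.

Definition tetra_point (y : nat -> R) (k : nat) : R := rsum 4 (fun m => y m * tetra_vertex m k).

Definition tetra_dot (m : nat) (v : nat -> R) : R := rsum 3 (fun k => v k * tetra_vertex m k).

Definition tetra_boundary (y : nat -> R) : Prop :=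
  (forall m, (m < 4)%nat -> 0 <= y m) /\ rsum 4 y = 1 /\ exists m, (m < 4)%nat /\ y m = 0.

Definition norm3 (v : nat -> R) : R := sqrt (rsum 3 (fun k => v k ^ 2)).

Lemma tetra_dot_point y m :
  (m < 4)%nat -> rsum 4 y = 1 -> tetra_dot m (tetra_point y) = 4 * y m - 1.
Proof.
  intros Hm Hy; rewrite <- Hy; revert m Hm.
  apply forall_lt_4; unfold tetra_dot, tetra_point, tetra_vertex; simpl; ring.
Qed.

Lemma tetra_point_dot v k :
  (k < 3)%nat -> tetra_point (fun m => (1 + tetra_dot m v) / 4) k = v k.
Proof.
  revert k; apply forall_lt_3; unfold tetra_dot, tetra_point, tetra_vertex; simpl; field.
Qed.

Lemma tetra_dot_sum v : rsum 4 (fun m => tetra_dot m v) = 0.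
Proof. unfold tetra_dot, tetra_vertex; simpl; ring. Qed.

Lemma tetra_dot_scal m c v w :
  (forall k, (k < 3)%nat -> v k = c * w k) -> tetra_dot m v = c * tetra_dot m w.
Proof.
  intros Hvw; unfold tetra_dot; rewrite <- rsum_scal; apply rsum_ext; intros k Hk.
  rewrite (Hvw k Hk); ring.
Qed.

Lemma norm3_pos v m : tetra_dot m v <> 0 -> 0 < norm3 v.
Proof.
  intros Hdot; destruct (rsum_nonzero_term _ _ Hdot) as (k & Hk & Hvk).
  apply sqrt_lt_R0, (rsum_pos 3 (fun k => v k ^ 2) k); [intros; apply pow2_ge_0|exact Hk|].
  apply pow2_gt_0; intros E; apply Hvk; rewrite E; ring.
Qed.

Lemma norm3_scal c v w :
  0 <= c -> (forall k, (k < 3)%nat -> v k = c * w k) -> norm3 v = c * norm3 w.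
Proof.
  intros Hc Hvw; unfold norm3. rewrite <- (sqrt_pow2 c) at 1 by exact Hc.
  rewrite <- sqrt_mult_alt, <- rsum_scal by apply pow2_ge_0. f_equal; apply rsum_ext.
  intros k Hk; rewrite (Hvw k Hk); ring.
Qed.

Lemma norm3_unit v : norm3 v = 1 <-> v 0%nat ^ 2 + v 1%nat ^ 2 + v 2%nat ^ 2 = 1.
Proof.
  unfold norm3; cbn [rsum]; rewrite Rplus_0_l; split.
  - intros Hv; apply (f_equal (fun t => t ^ 2)) in Hv. rewrite pow2_sqrt, pow1 in Hv; [exact Hv|].
    repeat apply Rplus_le_le_0_compat; apply pow2_ge_0.
  - intros ->; apply sqrt_1.
Qed.

Lemma tetra_boundary_norm_pos y : tetra_boundary y -> 0 < norm3 (tetra_point y).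
Proof.
  intros (_ & Hsum & m & Hm & Hy0); apply (norm3_pos _ m).
  rewrite tetra_dot_point, Hy0 by assumption; lra.
Qed.

Lemma tetra_boundary_scale_ge_1 c y y' :
  0 < c -> tetra_boundary y -> tetra_boundary y' ->
  (forall k, (k < 3)%nat -> tetra_point y k = c * tetra_point y' k) -> 1 <= c.
Proof.
  intros Hc (_ & Hsum & m & Hm & Hy0) (Hpos & Hsum' & _) Hyy.
  apply (tetra_dot_scal m) in Hyy. rewrite !tetra_dot_point, Hy0 in Hyy by assumption.
  specialize (Hpos m Hm). nra.
Qed.

Lemma tetra_boundary_radial_injective c y y' :
  0 < c -> tetra_boundary y -> tetra_boundary y' ->
  (forall k, (k < 3)%nat -> tetra_point y k = c * tetra_point y' k) ->
  forall m, (m < 4)%nat -> y m = y' m.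
Proof.
  intros Hc Hy Hy' Hyy m Hm.
  assert (Hge := tetra_boundary_scale_ge_1 c y y' Hc Hy Hy' Hyy).
  assert (Hle : 1 <= / c).
  { apply (tetra_boundary_scale_ge_1 (/ c) y' y); auto; [apply Rinv_0_lt_compat, Hc|].
    intros k Hk; rewrite (Hyy k Hk); field; lra. }
  assert (Hinv : c * / c = 1) by (field; lra). assert (Hc1 : c = 1) by nra.
  apply (tetra_dot_scal m) in Hyy.
  rewrite !tetra_dot_point in Hyy by (assumption || apply Hy || apply Hy'). rewrite Hc1 in Hyy; lra.
Qed.

Lemma exists_argmin m (f : nat -> R) :
  (0 < m)%nat -> exists i, (i < m)%nat /\ forall j, (j < m)%nat -> f i <= f j.
Proof.
  induction m as [|[|m] IH]; intros Hm; [lia| |].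
  - exists 0%nat; split; [lia|]; intros j Hj; replace j with 0%nat by lia; lra.
  - destruct IH as (i & Hi & Hmin); [lia|].
    destruct (Rle_dec (f i) (f (S m))) as [Hle|Hgt]; [exists i|exists (S m)];
      (split; [lia|]); intros j Hj; destruct (Nat.eq_dec j (S m)) as [->|]; try lra;
      specialize (Hmin j ltac:(lia)); lra.
Qed.

Lemma tetra_dot_min_negative v :
  norm3 v <> 0 -> exists m, (m < 4)%nat /\ tetra_dot m v < 0 /\
    forall m', (m' < 4)%nat -> tetra_dot m v <= tetra_dot m' v.
Proof.
  intros Hv; destruct (exists_argmin 4 (fun m => tetra_dot m v)) as (m & Hm & Hmin); [lia|].
  exists m; split; [exact Hm|]; split; [|exact Hmin].
  apply Rnot_le_lt; intros Hle; apply Hv.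
  assert (Hnn : forall m', (m' < 4)%nat -> 0 <= tetra_dot m' v)
    by (intros m' Hm'; specialize (Hmin m' Hm'); lra).
  assert (Hzero : forall m', (m' < 4)%nat -> tetra_dot m' v = 0).
  { intros m' Hm'; apply Rle_antisym; [|auto].
    rewrite <- (tetra_dot_sum v). apply (rsum_term_le 4 (fun m => tetra_dot m v)); auto. }
  unfold norm3; rewrite rsum_0; [apply sqrt_0|]. intros k Hk.
  rewrite <- (tetra_point_dot v k Hk). unfold tetra_point; simpl rsum.
  rewrite !Hzero by lia. revert k Hk; apply forall_lt_3; unfold tetra_vertex; simpl; field.
Qed.

Lemma tetra_boundary_radial_surjective z :
  norm3 z = 1 -> exists y c, 0 < c /\ tetra_boundary y /\
    forall k, (k < 3)%nat -> tetra_point y k = c * z k.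
Proof.
  intros Hz; destruct (tetra_dot_min_negative z) as (m & Hm & Hneg & Hmin); [lra|].
  set (c := / - tetra_dot m z). assert (Hc : 0 < c) by (apply Rinv_0_lt_compat; lra).
  assert (Hcm : c * tetra_dot m z = -1) by (unfold c; field; lra).
  set (v := fun k => c * z k).
  assert (Hdot : forall m', tetra_dot m' v = c * tetra_dot m' z)
    by (intros m'; apply tetra_dot_scal; reflexivity).
  exists (fun m' => (1 + tetra_dot m' v) / 4), c; split; [exact Hc|]; split.
  - split; [|split].
    + intros m' Hm'; specialize (Hmin m' Hm'); rewrite Hdot. nra.
    + assert (Hsum := tetra_dot_sum v); simpl in Hsum |- *; lra.
    + exists m; split; [exact Hm|]; rewrite Hdot, Hcm; field.
  - intros k Hk; apply tetra_point_dot, Hk.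
Qed.

Section Tetrahedral.

Variables N n : nat.
Hypothesis n_pos : (1 <= n)%nat.
Hypothesis N_eq : N = (4 * n)%nat.

(* The vertex [j + m * n] of the complex is the [m]-th vertex of the [j]-th tetrahedron. *)
Definition tetra_copy (j : nat) (y : nat -> R) : nat -> R :=
  fun i => rsum 4 (fun m => y m * kronecker (j + m * n) i).

Lemma rsum_tetra_copy j y c :
  (j < n)%nat ->
  rsum N (fun i => tetra_copy j y i * c i) = rsum 4 (fun m => y m * c (j + m * n)%nat).
Proof.
  intros Hj.
  transitivity (rsum N (fun i => rsum 4 (fun m => y m * (kronecker (j + m * n) i * c i)))).
  - apply rsum_ext; intros i _; unfold tetra_copy; simpl; ring.
  - rewrite rsum_swap; apply rsum_ext; intros m Hm.
    rewrite rsum_scal, rsum_kronecker_mul; [reflexivity|nia].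
Qed.

Lemma tetra_copy_sum j y : (j < n)%nat -> rsum N (tetra_copy j y) = rsum 4 y.
Proof.
  intros Hj; rewrite (rsum_ext N _ (fun i => tetra_copy j y i * 1)) by (intros; ring).
  rewrite (rsum_tetra_copy j y (fun _ => 1) Hj); apply rsum_ext; intros; ring.
Qed.

Lemma tetra_copy_at j y m : (m < 4)%nat -> tetra_copy j y (j + m * n)%nat = y m.
Proof.
  intros Hm; rewrite <- (rsum_kronecker_mul 4 m y Hm). apply rsum_ext; intros k _.
  destruct (Nat.eq_dec k m) as [->|Hne]; [rewrite !kronecker_same; ring|].
  rewrite !kronecker_diff; [ring|exact Hne|nia].
Qed.

Lemma tetra_copy_off j y i :
  (forall m, (m < 4)%nat -> y m <> 0 -> i <> (j + m * n)%nat) -> tetra_copy j y i = 0.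
Proof.
  intros Hoff; apply rsum_0; intros m Hm.
  destruct (Req_dec (y m) 0) as [->|Hym]; [ring|]. rewrite kronecker_diff by auto; ring.
Qed.

Lemma tetra_shift j m c :
  (j < n)%nat -> ((j + m * n + c * n) mod N = j + (m + c) mod 4 * n)%nat.
Proof.
  intros Hj; rewrite N_eq; symmetry; apply (Nat.mod_unique _ _ ((m + c) / 4)).
  - assert (Hlt := Nat.mod_upper_bound (m + c) 4); nia.
  - assert (Hdiv := Nat.div_mod_eq (m + c) 4); nia.
Qed.

Definition tetra_face (j m : nat) : list nat :=
  [j + (m + 1) mod 4 * n; j + (m + 2) mod 4 * n; j + (m + 3) mod 4 * n]%nat.

Lemma in_tetra_face j m i :
  (m < 4)%nat -> In i (tetra_face j m) <-> exists a, (a < 4)%nat /\ a <> m /\ i = (j + a * n)%nat.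
Proof.
  intros Hm; destruct m as [|[|[|[|m]]]]; [| | | |lia]; cbn -[Nat.mul]; (split;
    [ intros [<-|[<-|[<-|[]]]]; eexists; (split; [|split; [|reflexivity]]); lia
    | intros (a & Ha & Hne & ->); destruct a as [|[|[|[|a]]]]; tauto || lia]).
Qed.

Lemma tetra_face_simplex j m :
  (j < n)%nat -> (m < 4)%nat -> simplex_C N n n (2 * n) (tetra_face j m).
Proof.
  intros Hj Hm. set (k := (j + (m + 1) mod 4 * n)%nat).
  assert (Hk : (k < N)%nat)
    by (assert (Hlt := Nat.mod_upper_bound (m + 1) 4); unfold k; nia).
  replace (tetra_face j m) with [k; (k + n) mod N; (k + n + n) mod N]%nat;
    [apply triangle_up, Hk|].
  assert (Hshift := fun c => tetra_shift j ((m + 1) mod 4) c Hj); fold k in Hshift.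
  replace (k + n + n)%nat with (k + 2 * n)%nat by lia.
  replace (k + n)%nat with (k + 1 * n)%nat by lia. rewrite !Hshift.
  destruct m as [|[|[|[|m]]]]; [| | | |lia]; reflexivity.
Qed.

Lemma vertex_in_tetra_face j m c e :
  (j < n)%nat -> (m < 4)%nat -> (c mod 4 <> e mod 4)%nat ->
  In ((j + m * n + c * n) mod N)%nat (tetra_face j ((m + e) mod 4)).
Proof.
  intros Hj Hm Hce; rewrite tetra_shift by exact Hj.
  assert (Hlt := fun a => Nat.mod_upper_bound a 4 ltac:(lia)).
  apply in_tetra_face; [apply Hlt|]. exists ((m + c) mod 4)%nat.
  split; [apply Hlt|]; split; [|reflexivity].
  rewrite <- (Nat.Div0.add_mod_idemp_r m c 4), <- (Nat.Div0.add_mod_idemp_r m e 4).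
  assert (Hc := Hlt c). assert (He := Hlt e).
  assert (Hdivc := Nat.div_mod_eq (m + c mod 4) 4).
  assert (Hdive := Nat.div_mod_eq (m + e mod 4) 4). lia.
Qed.

Lemma simplex_in_tetra_face s :
  simplex_C N n n (2 * n) s -> exists j m, (j < n)%nat /\ (m < 4)%nat /\ incl s (tetra_face j m).
Proof.
  assert (Hvertex : forall k, (k < N)%nat -> exists j m, (j < n)%nat /\
    (forall e, (e mod 4 <> 0)%nat -> In k (tetra_face j ((m + e) mod 4))) /\
    forall c d e, (d = c * n)%nat -> (c mod 4 <> e mod 4)%nat ->
      In ((k + d) mod N)%nat (tetra_face j ((m + e) mod 4))).
  { intros k Hk; exists (k mod n)%nat, (k / n)%nat.
    assert (Hlt := Nat.mod_upper_bound k n ltac:(lia)). assert (Hdiv := Nat.div_mod_eq k n).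
    assert (Hm : (k / n < 4)%nat) by (apply Nat.Div0.div_lt_upper_bound; lia).
    assert (Hin := fun c e => vertex_in_tetra_face (k mod n) (k / n) c e Hlt Hm).
    replace (k mod n + k / n * n)%nat with k in Hin by lia.
    split; [exact Hlt|]; split; [|intros c d e ->; apply Hin].
    intros e He; specialize (Hin 0%nat e). rewrite Nat.mul_0_l, Nat.add_0_r in Hin.
    rewrite (Nat.mod_small k N Hk) in Hin. apply Hin; simpl; auto. }
  assert (Hlt4 := fun m => Nat.mod_upper_bound m 4 ltac:(lia)).
  intros [(k & Hk & ->)|[(k & l & Hk & Hl & ->)|(k & Hk & [-> | ->])]];
    destruct (Hvertex k Hk) as (j & m & Hj & Hself & Hin); exists j;
    rewrite <- ?Nat.add_assoc.
  - exists ((m + 3) mod 4)%nat; repeat split; auto.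
    intros i [<-|[]]; apply Hself; discriminate.
  - exists ((m + 3) mod 4)%nat; repeat split; auto.
    intros i [<-|[<-|[]]]; [apply Hself; discriminate|].
    destruct Hl as [-> |[-> | ->]];
      [apply (Hin 1%nat)|apply (Hin 1%nat)|apply (Hin 2%nat)]; discriminate || lia.
  - exists ((m + 3) mod 4)%nat; repeat split; auto.
    intros i [<-|[<-|[<-|[]]]]; [apply Hself|apply (Hin 1%nat)|apply (Hin 2%nat)];
      discriminate || lia.
  - exists ((m + 1) mod 4)%nat; repeat split; auto.
    intros i [<-|[<-|[<-|[]]]]; [apply Hself|apply (Hin 3%nat)|apply (Hin 6%nat)];
      discriminate || lia.
Qed.

Lemma tetra_copy_realization j y :
  (j < n)%nat -> tetra_boundary y -> realization N n n (2 * n) (tetra_copy j y).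
Proof.
  intros Hj (Hpos & Hsum & m & Hm & Hy0); apply realization_face.
  exists (tetra_face j m); split; [apply tetra_face_simplex; assumption|].
  split; [|split; [|split]].
  - intros i Hi; apply tetra_copy_off; intros a Ha _; nia.
  - intros i; apply rsum_nonneg; intros a Ha.
    apply Rmult_le_pos; [auto|apply kronecker_nonneg].
  - rewrite tetra_copy_sum; assumption.
  - intros i Hi; apply in_tetra_face; [exact Hm|]. apply NNPP; intros Hnone.
    apply Hi, tetra_copy_off; intros a Ha Hya E; apply Hnone; exists a.
    repeat split; auto. intros ->; auto.
Qed.

Lemma realization_tetra_copy x :
  realization N n n (2 * n) x ->
  exists j y, (j < n)%nat /\ tetra_boundary y /\ x = tetra_copy j y.
Proof.
  intros Hx; apply realization_face in Hx; destruct Hx as (s & Hs & Hx).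
  destruct (simplex_in_tetra_face s Hs) as (j & m & Hj & Hm & Hincl).
  destruct (face_incl _ _ _ _ Hincl Hx) as (_ & Hpos & Hsum & Hsup).
  set (y := fun a => x (j + a * n)%nat).
  assert (Ex : x = tetra_copy j y).
  { apply functional_extensionality; intros i.
    destruct (classic (exists a, (a < 4)%nat /\ i = (j + a * n)%nat)) as [(a & Ha & ->)|Hnone].
    - rewrite tetra_copy_at by exact Ha; reflexivity.
    - rewrite tetra_copy_off by eauto. apply NNPP; intros Hxi; apply Hnone.
      destruct (proj1 (in_tetra_face j m i Hm) (Hsup i Hxi)) as (a & Ha & _ & E); eauto. }
  exists j, y; split; [exact Hj|]; split; [|exact Ex].
  split; [intros a _; apply Hpos|]; split.
  - rewrite <- Hsum, Ex, tetra_copy_sum by exact Hj; reflexivity.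
  - exists m; split; [exact Hm|]. apply NNPP; intros Hym.
    destruct (proj1 (in_tetra_face j m _ Hm) (Hsup _ Hym)) as (a & Ha & Hne & E).
    apply Hne; nia.
Qed.

Definition tetra_barycentre (x : nat -> R) (k : nat) : R :=
  rsum N (fun i => x i * tetra_vertex (i / n) k).

Definition tetra_map (x : nat -> R) (k : nat) : R :=
  match k with
  | 0%nat | 1%nat | 2%nat => tetra_barycentre x k / norm3 (tetra_barycentre x)
  | 3%nat => rsum N (fun i => x i * INR (i mod n))
  | _ => 0
  end.

Lemma tetra_barycentre_copy j y : (j < n)%nat -> tetra_barycentre (tetra_copy j y) = tetra_point y.
Proof.
  intros Hj; apply functional_extensionality; intros k; unfold tetra_barycentre.
  rewrite (rsum_tetra_copy j y (fun i => tetra_vertex (i / n) k) Hj).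
  apply rsum_ext; intros m _; do 2 f_equal.
  symmetry; apply (Nat.div_unique _ _ _ j); lia.
Qed.

Lemma tetra_map_copy_level j y :
  (j < n)%nat -> rsum 4 y = 1 -> tetra_map (tetra_copy j y) 3 = INR j.
Proof.
  intros Hj Hy; unfold tetra_map. rewrite (rsum_tetra_copy j y (fun i => INR (i mod n)) Hj).
  rewrite <- (Rmult_1_r (INR j)), <- Hy, <- rsum_scal; apply rsum_ext; intros m _.
  rewrite Rmult_comm; do 2 f_equal. symmetry; apply (Nat.mod_unique _ _ m); lia.
Qed.

Lemma tetra_map_direction x k :
  (k < 3)%nat -> tetra_map x k = tetra_barycentre x k / norm3 (tetra_barycentre x).
Proof. revert k; apply forall_lt_3; reflexivity. Qed.

Lemma tetra_barycentre_norm_pos x :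
  realization N n n (2 * n) x -> 0 < norm3 (tetra_barycentre x).
Proof.
  intros Hx; destruct (realization_tetra_copy x Hx) as (j & y & Hj & Hy & ->).
  rewrite tetra_barycentre_copy by exact Hj; apply tetra_boundary_norm_pos, Hy.
Qed.

Lemma tetra_map_continuous : continuous_on N 4 (realization N n n (2 * n)) tetra_map.
Proof.
  apply continuous_on_coords; intros k Hk.
  destruct (Nat.eq_dec k 3) as [->|Hk3]; [unfold tetra_map; continuity_real|].
  apply (continuous_real_ext N _
    (fun x => tetra_barycentre x k / norm3 (tetra_barycentre x))).
  - intros x _; symmetry; apply tetra_map_direction; lia.
  - apply continuous_real_div; [unfold tetra_barycentre; continuity_real| |].
    + unfold norm3, tetra_barycentre; continuity_real.
    + intros x Hx; apply Rgt_not_eq, tetra_barycentre_norm_pos, Hx.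
Qed.

Lemma tetra_map_spheres x : realization N n n (2 * n) x -> spheres n (tetra_map x).
Proof.
  intros Hx; assert (Hnorm := tetra_barycentre_norm_pos x Hx).
  split; [intros [|[|[|[|k]]]] Hk; try lia; reflexivity|]; split.
  - destruct (realization_tetra_copy x Hx) as (j & y & Hj & Hy & ->).
    exists j; split; [exact Hj|]. apply tetra_map_copy_level; [exact Hj|apply Hy].
  - apply norm3_unit. rewrite (norm3_scal (/ norm3 (tetra_barycentre x)) _ (tetra_barycentre x)).
    + field; lra.
    + left; apply Rinv_0_lt_compat, Hnorm.
    + intros k Hk; rewrite tetra_map_direction by exact Hk; apply Rmult_comm.
Qed.

Lemma tetra_map_surjective z :
  spheres n z -> exists x, realization N n n (2 * n) x /\ tetra_map x = z.
Proof.
  intros (Hin & (j & Hj & Ej) & Hz); apply norm3_unit in Hz.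
  destruct (tetra_boundary_radial_surjective z Hz) as (y & c & Hc & Hy & Hyz).
  exists (tetra_copy j y); split; [apply tetra_copy_realization; assumption|].
  apply (in_Rd_ext 4); [intros [|[|[|[|k]]]] Hk; try lia; reflexivity|exact Hin|].
  intros k Hk; destruct (Nat.eq_dec k 3) as [->|Hk3].
  - rewrite Ej; apply tetra_map_copy_level; [exact Hj|apply Hy].
  - rewrite tetra_map_direction, tetra_barycentre_copy, (Hyz k) by (assumption || lia).
    rewrite (norm3_scal c _ z), Hz by (assumption || lra). field; lra.
Qed.

Lemma tetra_map_injective : injective_on (realization N n n (2 * n)) tetra_map.
Proof.
  intros x x' Hx Hx' E.
  destruct (realization_tetra_copy x Hx) as (j & y & Hj & Hy & ->).
  destruct (realization_tetra_copy x' Hx') as (j' & y' & Hj' & Hy' & ->).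
  assert (Ejj : j = j').
  { apply INR_eq. rewrite <- (tetra_map_copy_level j y), <- (tetra_map_copy_level j' y');
      [rewrite E; reflexivity|exact Hj'|apply Hy'|exact Hj|apply Hy]. }
  subst j'.
  assert (Hn := tetra_boundary_norm_pos y Hy). assert (Hn' := tetra_boundary_norm_pos y' Hy').
  assert (Hyy : forall m, (m < 4)%nat -> y m = y' m).
  { apply (tetra_boundary_radial_injective (norm3 (tetra_point y) / norm3 (tetra_point y'))); auto;
      [apply Rdiv_lt_0_compat; assumption|].
    intros k Hk; assert (Ek := f_equal (fun z => z k) E); cbv beta in Ek.
    rewrite !tetra_map_direction, !tetra_barycentre_copy in Ek by assumption.
    replace (tetra_point y k) with (tetra_point y k / norm3 (tetra_point y) * norm3 (tetra_point y))
      by (field; lra).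
    rewrite Ek; field; lra. }
  apply functional_extensionality; intros i; apply rsum_ext; intros m Hm; rewrite Hyy; auto.
Qed.

Lemma tetrahedral_complex_spheres : homeomorphic N (realization N n n (2 * n)) 4 (spheres n).
Proof.
  apply (homeomorphic_of_same_fibres N N 4 (realization N n n (2 * n)) _ _ (fun x => x) tetra_map).
  - apply realization_compact.
  - intros x Hx; apply Hx.
  - intros x Hx; apply Hx.
  - auto.
  - eauto.
  - exact tetra_map_spheres.
  - exact tetra_map_surjective.
  - apply continuous_on_coords; intros i Hi; apply continuous_real_coord, Hi.
  - exact tetra_map_continuous.
  - intros x y Hx Hy; split; [intros ->; reflexivity|apply tetra_map_injective; assumption].
Qed.

End Tetrahedral.

(** * Lattices of the plane *)

Section Lattice.
Local Open Scope Z_scope.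

Lemma subgroup_Z_cyclic (H : Z -> Prop) :
  (forall a b, H a -> H b -> H (a - b)) -> (exists a, 0 < a /\ H a) ->
  exists p, 0 < p /\ forall a, H a <-> (p | a).
Proof.
  intros Hsub [a0 [Ha0 Ha0H]].
  destruct (dec_inh_nat_subset_has_unique_least_element
    (fun n => 0 < Z.of_nat n /\ H (Z.of_nat n))) as (n & [[Hn HnH] Hmin] & _).
  - intros n; apply classic.
  - exists (Z.to_nat a0); rewrite Z2Nat.id by lia; auto.
  - set (p := Z.of_nat n) in *.
    assert (H0 : H 0) by (rewrite <- (Z.sub_diag p); auto).
    assert (Hadd : forall a b, H a -> H b -> H (a + b))
      by (intros a b Ha Hb; replace (a + b) with (a - (0 - b)) by ring; auto).
    assert (Hmul : forall c, H (c * p)).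
    { intros c; pattern c; apply Z.peano_ind; [exact H0| |]; intros x Hx.
      - rewrite Z.mul_succ_l; auto.
      - rewrite Z.mul_pred_l; auto. }
    exists p; split; [exact Hn|]; intros a; split; [|intros [c ->]; apply Hmul].
    intros Ha; apply Z.mod_divide; [lia|]. assert (Hr := Z.mod_pos_bound a p Hn).
    assert (HrH : H (a mod p)) by (rewrite Z.mod_eq, Z.mul_comm by lia; auto).
    destruct (Z.eq_dec (a mod p) 0) as [|Hne]; [assumption|].
    specialize (Hmin (Z.to_nat (a mod p))). rewrite Z2Nat.id in Hmin by lia.
    specialize (Hmin ltac:(split; [lia|exact HrH])). lia.
Qed.

Lemma planar_lattice_basis (L : Z -> Z -> Prop) :
  (forall a b a' b', L a b -> L a' b' -> L (a - a') (b - b')) ->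
  (exists a, 0 < a /\ L a 0) -> (exists b, 0 < b /\ L 0 b) ->
  exists p q r, 0 < p /\ 0 < q /\ forall a b, L a b <-> exists m n, a = m * p + n * r /\ b = n * q.
Proof.
  intros Hsub Hfst [b0 [Hb0 Hb0L]].
  destruct (subgroup_Z_cyclic (fun a => L a 0)) as (p & Hp & HpL); [|exact Hfst|].
  { intros a a' Ha Ha'; apply (Hsub a 0 a' 0 Ha Ha'). }
  destruct (subgroup_Z_cyclic (fun b => exists a, L a b)) as (q & Hq & HqL); [|eauto|].
  { intros b b' [a Ha] [a' Ha']; eauto. }
  destruct (proj2 (HqL q) (Z.divide_refl q)) as [r Hr].
  destruct (subgroup_Z_cyclic (fun n => L (n * r) (n * q))) as (c & _ & Hc).
  { intros n n' Hn Hn'; rewrite !Z.mul_sub_distr_r; auto. }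
  { exists 1; rewrite !Z.mul_1_l; split; [lia|exact Hr]. }
  assert (Hmul : forall n, L (n * r) (n * q)).
  { intros n; apply Hc, (Z.divide_trans _ 1); [|apply Z.divide_1_l].
    apply Hc; rewrite !Z.mul_1_l; exact Hr. }
  exists p, q, r; split; [exact Hp|]; split; [exact Hq|]; intros a b; split.
  - intros Hab. destruct (proj1 (HqL b)) as [n ->]; [eauto|].
    destruct (proj1 (HpL (a - n * r))) as [m Hm].
    + rewrite <- (Z.sub_diag (n * q)); auto.
    + exists m, n; split; [lia|reflexivity].
  - intros (m & n & -> & ->).
    replace (m * p + n * r) with (m * p - - n * r) by ring.
    replace (n * q) with (0 - - n * q) by ring.
    apply Hsub; [apply HpL; exists m; reflexivity|apply Hmul].
Qed.

Lemma period_lattice_basis (N n1 n2 : Z) : 0 < N ->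
  exists p q r, 0 < p /\ 0 < q /\ forall a b,
    (N | a * n1 + b * n2) <-> exists m n, a = m * p + n * r /\ b = n * q.
Proof.
  intros HN; apply planar_lattice_basis.
  - intros a b a' b' Hab Hab'.
    replace ((a - a') * n1 + (b - b') * n2) with (a * n1 + b * n2 - (a' * n1 + b' * n2)) by ring.
    apply Z.divide_sub_r; assumption.
  - exists N; split; [exact HN|exists n1; ring].
  - exists N; split; [exact HN|exists n2; ring].
Qed.

End Lattice.

Lemma nat_mod_eq_Z a b N :
  (0 < N)%nat -> (a mod N = b mod N)%nat <-> (Z.of_nat N | Z.of_nat a - Z.of_nat b)%Z.
Proof.
  intros HN; split.
  - intros E. apply (f_equal Z.of_nat) in E. rewrite !Nat2Z.inj_mod in E.
    apply Z.mod_divide; [lia|]. rewrite Zminus_mod, E, Z.sub_diag. apply Z.mod_0_l; lia.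
  - intros [c Hc]. apply Nat2Z.inj; rewrite !Nat2Z.inj_mod.
    replace (Z.of_nat a) with (Z.of_nat b + c * Z.of_nat N)%Z by lia.
    apply Z_mod_plus_full.
Qed.

Definition component_count (N n1 n2 : nat) : nat :=
  Z.to_nat (Z.gcd (Z.of_nat n1) (Z.gcd (Z.of_nat n2) (Z.of_nat N))).

Section Components.

Variables N n1 n2 : nat.
Hypothesis N_pos : (0 < N)%nat.

Let g := component_count N n1 n2.

Lemma component_count_Z :
  Z.of_nat g = Z.gcd (Z.of_nat n1) (Z.gcd (Z.of_nat n2) (Z.of_nat N)).
Proof. apply Z2Nat.id, Z.gcd_nonneg. Qed.

Lemma component_count_pos : (0 < g)%nat.
Proof.
  assert (Hg := component_count_Z). apply Nat.neq_0_lt_0; intros E; rewrite E in Hg.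
  symmetry in Hg; apply Z.gcd_eq_0_r, Z.gcd_eq_0_r in Hg; lia.
Qed.

Lemma component_count_divide :
  (Z.of_nat g | Z.of_nat n1)%Z /\ (Z.of_nat g | Z.of_nat n2)%Z /\ (Z.of_nat g | Z.of_nat N)%Z.
Proof.
  rewrite component_count_Z.
  assert (Hd := Z.gcd_divide_r (Z.of_nat n1) (Z.gcd (Z.of_nat n2) (Z.of_nat N))).
  split; [apply Z.gcd_divide_l|]; split; (eapply Z.divide_trans; [exact Hd|]);
    [apply Z.gcd_divide_l|apply Z.gcd_divide_r].
Qed.

Lemma component_count_bezout :
  exists x y, (Z.of_nat N | Z.of_nat g - (x * Z.of_nat n1 + y * Z.of_nat n2))%Z.
Proof.
  rewrite component_count_Z.
  destruct (Z.gcd_bezout (Z.of_nat n1) (Z.gcd (Z.of_nat n2) (Z.of_nat N)) _ eq_refl)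
    as (x & y & <-).
  destruct (Z.gcd_bezout (Z.of_nat n2) (Z.of_nat N) _ eq_refl) as (z & w & <-).
  exists x, (y * z)%Z, (y * w)%Z; ring.
Qed.

Lemma vertex_reached k :
  exists A B, (A < N)%nat /\ (B < N)%nat /\ ((k mod g + A * n1 + B * n2) mod N = k mod N)%nat.
Proof.
  destruct component_count_bezout as (x & y & w & Hw).
  set (c := Z.of_nat (k / g)). set (M := Z.of_nat N) in *.
  assert (HM : (0 < M)%Z) by (unfold M; lia).
  assert (HA := Z.mod_pos_bound (c * x) M HM). assert (HB := Z.mod_pos_bound (c * y) M HM).
  exists (Z.to_nat ((c * x) mod M)), (Z.to_nat ((c * y) mod M)).
  split; [unfold M in *; lia|]; split; [unfold M in *; lia|].
  apply nat_mod_eq_Z; [exact N_pos|]. fold M.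
  rewrite !Nat2Z.inj_add, !Nat2Z.inj_mul, !Z2Nat.id by lia.
  assert (Hk := Nat.div_mod_eq k g). apply (f_equal Z.of_nat) in Hk.
  rewrite Nat2Z.inj_add, Nat2Z.inj_mul in Hk; fold c in Hk.
  assert (Hx := Z.div_mod (c * x) M ltac:(lia)). assert (Hy := Z.div_mod (c * y) M ltac:(lia)).
  exists (- (w * c) - (c * x) / M * Z.of_nat n1 - (c * y) / M * Z.of_nat n2)%Z.
  rewrite Hk. replace (Z.of_nat g) with (x * Z.of_nat n1 + y * Z.of_nat n2 + w * M)%Z by lia.
  replace ((c * x) mod M)%Z with (c * x - M * (c * x / M))%Z by lia.
  replace ((c * y) mod M)%Z with (c * y - M * (c * y / M))%Z by lia. ring.
Qed.

Lemma component_unique j j' A B A' B' :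
  (j < g)%nat -> (j' < g)%nat ->
  ((j + A * n1 + B * n2) mod N = (j' + A' * n1 + B' * n2) mod N)%nat -> j = j'.
Proof.
  intros Hj Hj' Hmod; apply nat_mod_eq_Z in Hmod; [|exact N_pos].
  destruct component_count_divide as ([x1 E1] & [x2 E2] & HgN).
  assert (Hdvd := Z.divide_trans _ _ _ HgN Hmod).
  rewrite !Nat2Z.inj_add, !Nat2Z.inj_mul, E1, E2 in Hdvd. destruct Hdvd as [c Hc].
  assert (Hjj : (Z.of_nat g | Z.of_nat j - Z.of_nat j')%Z).
  { exists (c - (Z.of_nat A - Z.of_nat A') * x1 - (Z.of_nat B - Z.of_nat B') * x2)%Z. lia. }
  destruct Hjj as [e He]. assert (e = 0)%Z by nia. subst e; lia.
Qed.

End Components.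

(** * The circle *)

Lemma cos_sin_shift x (m : Z) :
  cos (x + 2 * PI * IZR m) = cos x /\ sin (x + 2 * PI * IZR m) = sin x.
Proof.
  assert (Hnat : forall (y : R) (k : nat), cos (y + 2 * PI * INR k) = cos y /\
    sin (y + 2 * PI * INR k) = sin y).
  { intros y k; replace (y + 2 * PI * INR k) with (y + 2 * INR k * PI) by ring.
    split; [apply cos_period|apply sin_period]. }
  destruct (Z.le_ge_cases 0 m) as [Hm|Hm].
  - destruct (Hnat x (Z.to_nat m)) as [Hc Hs].
    rewrite INR_IZR_INZ, Z2Nat.id in Hc, Hs by exact Hm. auto.
  - destruct (Hnat (x + 2 * PI * IZR m) (Z.to_nat (- m))) as [Hc Hs].
    rewrite INR_IZR_INZ, Z2Nat.id, opp_IZR in Hc, Hs by lia.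
    replace (x + 2 * PI * IZR m + 2 * PI * - IZR m) with x in Hc, Hs by ring. auto.
Qed.

Lemma cos_sin_eq x y :
  cos x = cos y /\ sin x = sin y <-> exists m : Z, x = y + 2 * PI * IZR m.
Proof.
  split; [|intros [m ->]; apply cos_sin_shift].
  intros [Hc Hs].
  assert (Hcos : cos (x - y) = 1).
  { rewrite cos_minus, Hc, Hs. assert (Hpyth := sin2_cos2 y). unfold Rsqr in Hpyth; lra. }
  assert (Hsin : sin (x - y) = 0) by (rewrite sin_minus, Hc, Hs; ring).
  destruct (sin_eq_0_0 _ Hsin) as [k Hk].
  destruct (Z.Even_or_Odd k) as [[m ->]|[m ->]].
  - exists m. rewrite mult_IZR in Hk. lra.
  - exfalso. rewrite Hk, plus_IZR, mult_IZR in Hcos.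
    replace ((2 * IZR m + 1) * PI) with (PI + 2 * PI * IZR m) in Hcos by ring.
    rewrite (proj1 (cos_sin_shift PI m)), cos_PI in Hcos; lra.
Qed.

Lemma unit_circle_angle x y : x ^ 2 + y ^ 2 = 1 -> exists t, cos t = x /\ sin t = y.
Proof.
  intros Hxy. assert (Hx : -1 <= x <= 1) by (split; nra).
  assert (Hs : forall s, 0 <= s -> x ^ 2 + s ^ 2 = 1 -> sin (acos x) = s).
  { intros s Hs0 E; rewrite sin_acos by exact Hx.
    replace (1 - x²) with (s ^ 2) by (unfold Rsqr; lra). apply sqrt_pow2, Hs0. }
  destruct (Rle_dec 0 y) as [Hy|Hy].
  - exists (acos x); split; [apply cos_acos, Hx|apply Hs; assumption].
  - exists (- acos x); split; [rewrite cos_neg; apply cos_acos, Hx|].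
    rewrite sin_neg, (Hs (- y)); [ring|lra|rewrite <- Hxy; ring].
Qed.

(** * The universal cover of the non-degenerate complexes *)

(* The piecewise linear function that is 1 at the origin and 0 at the other vertices of the
   triangulation of the plane with vertex set Z^2 and edge directions (1,0), (0,1), (1,1). *)
Definition hat (u v : R) : R :=
  Rmax 0 (1 - Rmax (Rabs u) (Rmax (Rabs v) (Rabs (u - v)))).

Lemma hat_lower u v :
  0 <= v <= u -> u <= 1 ->
  hat u v = 1 - u /\ hat (u - 1) v = u - v /\ hat u (v - 1) = 0 /\ hat (u - 1) (v - 1) = v.
Proof.
  intros Hvu Hu1; unfold hat.
  rewrite (Rabs_pos_eq u), (Rabs_pos_eq v), (Rabs_left1 (u - 1)), (Rabs_left1 (v - 1)) by lra.
  rewrite (Rabs_pos_eq (u - v)), (Rabs_left1 (u - 1 - v)), (Rabs_pos_eq (u - (v - 1))) by lra.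
  rewrite (Rabs_pos_eq (u - 1 - (v - 1))) by lra.
  repeat split; unfold Rmax; repeat destruct (Rle_dec _ _); lra.
Qed.

Lemma hat_sym u v : hat u v = hat v u.
Proof.
  unfold hat; rewrite (Rabs_minus_sym u v), Rmax_assoc, (Rmax_comm (Rabs u)), <- Rmax_assoc.
  reflexivity.
Qed.

Lemma hat_upper u v :
  0 <= u <= v -> v <= 1 ->
  hat u v = 1 - v /\ hat (u - 1) v = 0 /\ hat u (v - 1) = v - u /\ hat (u - 1) (v - 1) = u.
Proof.
  intros Huv Hv1; destruct (hat_lower v u Huv Hv1) as (H00 & H10 & H01 & H11).
  rewrite (hat_sym u), (hat_sym (u - 1)), (hat_sym u (v - 1)), (hat_sym (u - 1)); auto.
Qed.

Lemma hat_far u v : 1 <= Rabs u \/ 1 <= Rabs v -> hat u v = 0.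
Proof.
  intros Huv; unfold hat; apply Rmax_left.
  assert (Hu := Rmax_l (Rabs u) (Rmax (Rabs v) (Rabs (u - v)))).
  assert (Hv := Rmax_r (Rabs u) (Rmax (Rabs v) (Rabs (u - v)))).
  assert (Hv' := Rmax_l (Rabs v) (Rabs (u - v))).
  destruct Huv; lra.
Qed.

Definition bump (t : R) : R := Rmax 0 (1 - Rabs t).

Lemma bump_INR j l : bump (INR j - INR l) = kronecker j l.
Proof.
  unfold bump, kronecker; destruct (Nat.eqb_spec l j) as [->|Hne].
  - rewrite Rminus_diag, Rabs_R0, Rmax_right; lra.
  - apply Rmax_left. assert (1 <= Rabs (INR j - INR l)); [|lra].
    rewrite !INR_IZR_INZ, <- minus_IZR, <- abs_IZR; apply IZR_le; lia.
Qed.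

Lemma rsum_two_terms M A f :
  (S A < M)%nat -> (forall a, (a < M)%nat -> a <> A -> a <> S A -> f a = 0) ->
  rsum M f = rsum 2 (fun e => f (A + e)%nat).
Proof.
  intros HA Hoff; cbn [rsum]; rewrite Rplus_0_l, Nat.add_0_r, Nat.add_1_r.
  rewrite (rsum_ext M f (fun a => kronecker A a * f a + kronecker (S A) a * f a)).
  - rewrite rsum_plus, !rsum_kronecker_mul by lia; reflexivity.
  - intros a Ha. destruct (Nat.eq_dec a A) as [->|HaA].
    + rewrite kronecker_same, kronecker_diff by lia; ring.
    + destruct (Nat.eq_dec a (S A)) as [->|HaS].
      * rewrite kronecker_same, kronecker_diff by lia; ring.
      * rewrite Hoff, !kronecker_diff by assumption; ring.
Qed.

Lemma far_from_cell (a A : nat) u :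
  0 <= u <= 1 -> a <> A -> a <> S A -> 1 <= Rabs (INR A + u - INR a).
Proof.
  intros Hu HaA HaS. destruct (Nat.lt_ge_cases a A) as [Hlt|Hge].
  - assert (Hle : INR (S a) <= INR A) by (apply le_INR; lia). rewrite S_INR in Hle.
    rewrite Rabs_pos_eq; lra.
  - assert (Hle : INR (A + 2) <= INR a) by (apply le_INR; lia).
    rewrite plus_INR in Hle; simpl in Hle. rewrite Rabs_left; lra.
Qed.

Lemma real_shift_into_range (N x : R) : 0 < N -> exists m : Z, 0 <= x + N * IZR m <= N.
Proof.
  intros HN. destruct (archimed (x / N)) as [Hup Hup1].
  assert (Ex : x / N * N = x) by (field; lra).
  exists (1 - up (x / N))%Z. rewrite minus_IZR. split; nra.
Qed.

Section Torus.

Variables N n1 n2 n3 : nat.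
Hypothesis n1_pos : (1 <= n1)%nat.
Hypothesis n1_lt_n2 : (n1 < n2)%nat.
Hypothesis n2_lt_n3 : (n2 < n3)%nat.
Hypothesis sum_n : (n1 + n2 + n3)%nat = N.
Hypothesis n3_neq : n3 <> (n1 + n2)%nat.

Let g := component_count N n1 n2.

(* Image of [(A + u, B + v)] when the vertex [(A, B)] is sent to [k mod N]. *)
Definition cell_point (k : nat) (u v : R) : nat -> R := fun i =>
  rsum 2 (fun ea => rsum 2 (fun eb =>
    hat (u - INR ea) (v - INR eb) * kronecker ((k + (ea * n1 + eb * n2)) mod N) i)).

Lemma cell_point_corners k u v i :
  cell_point k u v i =
    hat u v * kronecker (k mod N) i + hat (u - 1) v * kronecker ((k + n1) mod N) i +
    hat u (v - 1) * kronecker ((k + n2) mod N) i +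
    hat (u - 1) (v - 1) * kronecker ((k + (n1 + n2)) mod N) i.
Proof.
  unfold cell_point; cbn [rsum INR Nat.mul Nat.add]; rewrite !Nat.add_0_r, !Rminus_0_r; ring.
Qed.

Lemma add_mod_congr k k' c :
  (k mod N = k' mod N)%nat -> ((k + c) mod N = (k' + c) mod N)%nat.
Proof.
  intros E; rewrite <- (Nat.Div0.add_mod_idemp_l k), E, Nat.Div0.add_mod_idemp_l; reflexivity.
Qed.

Lemma cell_point_mod k k' u v :
  (k mod N = k' mod N)%nat -> cell_point k u v = cell_point k' u v.
Proof.
  intros E; apply functional_extensionality; intros i.
  do 2 (apply rsum_ext; intros ? _); rewrite (add_mod_congr k k' _ E); reflexivity.
Qed.

Lemma cell_point_lower k u v :
  0 <= v <= u -> u <= 1 ->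
  cell_point k u v =
    bary (k mod N) ((k + n1) mod N) ((k + (n1 + n2)) mod N) (1 - u) (u - v) v.
Proof.
  intros Hvu Hu; apply functional_extensionality; intros i.
  destruct (hat_lower u v Hvu Hu) as (H00 & H10 & H01 & H11).
  rewrite cell_point_corners, H00, H10, H01, H11; unfold bary; ring.
Qed.

Lemma cell_point_upper k u v :
  0 <= u <= v -> v <= 1 ->
  cell_point k u v =
    bary ((k + (n1 + n2)) mod N) ((k + n2) mod N) (k mod N) u (v - u) (1 - v).
Proof.
  intros Huv Hv; apply functional_extensionality; intros i.
  destruct (hat_upper u v Huv Hv) as (H00 & H10 & H01 & H11).
  rewrite cell_point_corners, H00, H10, H01, H11; unfold bary; ring.
Qed.

Definition lower_triangle (k : nat) : list nat :=
  [k mod N; (k + n1) mod N; (k + (n1 + n2)) mod N]%nat.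

Definition upper_triangle (k : nat) : list nat :=
  [(k + (n1 + n2)) mod N; (k + n2) mod N; k mod N]%nat.

Lemma lower_triangle_simplex k : simplex_C N n1 n2 n3 (lower_triangle k).
Proof.
  assert (Hk : (k mod N < N)%nat) by (apply Nat.mod_upper_bound; lia).
  assert (Htri := triangle_up N n1 n2 n3 _ Hk).
  rewrite <- Nat.add_assoc, !Nat.Div0.add_mod_idemp_l in Htri; exact Htri.
Qed.

Lemma upper_triangle_simplex k : simplex_C N n1 n2 n3 (upper_triangle k).
Proof.
  assert (Hk : ((k + (n1 + n2)) mod N < N)%nat) by (apply Nat.mod_upper_bound; lia).
  assert (Htri := triangle_down N n1 n2 n3 _ Hk).
  rewrite <- Nat.add_assoc, !Nat.Div0.add_mod_idemp_l in Htri.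
  replace (k + (n1 + n2) + (N - n1))%nat with (k + n2 + 1 * N)%nat in Htri by lia.
  replace (k + (n1 + n2) + (N - n1 + (N - n2)))%nat with (k + 2 * N)%nat in Htri by lia.
  rewrite !Nat.Div0.mod_add in Htri; exact Htri.
Qed.

Lemma simplex_in_triangle s :
  simplex_C N n1 n2 n3 s -> exists k, incl s (lower_triangle k) \/ incl s (upper_triangle k).
Proof.
  assert (Hback : forall k, (k < N)%nat -> ((k + n3 + (n1 + n2)) mod N = k)%nat).
  { intros k Hk; replace (k + n3 + (n1 + n2))%nat with (k + 1 * N)%nat by lia.
    rewrite Nat.Div0.mod_add; apply Nat.mod_small, Hk. }
  intros [(k & Hk & ->)|[(k & j & Hk & Hj & ->)|(k & Hk & [-> | ->])]];
    assert (Ek := Nat.mod_small k N Hk).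
  - exists k; left; intros i; unfold lower_triangle; rewrite Ek; simpl; tauto.
  - destruct Hj as [-> | [-> | ->]]; [exists k; left|exists k; right|exists (k + n3)%nat; left];
      intros i; unfold lower_triangle, upper_triangle; rewrite ?Ek, ?Hback by exact Hk;
      simpl; tauto.
  - exists k; left; intros i; unfold lower_triangle; rewrite Ek, Nat.add_assoc; simpl; tauto.
  - exists (k + n3)%nat; right; intros i; unfold upper_triangle; rewrite Hback by exact Hk.
    replace (k + (N - n1))%nat with (k + n3 + n2)%nat by lia.
    replace (k + n3 + n2 + (N - n2))%nat with (k + n3 + 1 * N)%nat by lia.
    rewrite Nat.Div0.mod_add; simpl; tauto.
Qed.

Lemma cell_vertices_distinct k :
  (k mod N <> (k + n1) mod N /\ k mod N <> (k + n2) mod N /\ k mod N <> (k + (n1 + n2)) mod N /\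
   (k + n1) mod N <> (k + (n1 + n2)) mod N /\ (k + n2) mod N <> (k + (n1 + n2)) mod N)%nat.
Proof.
  assert (Hk := Nat.mod_upper_bound k N ltac:(lia)).
  rewrite <- !(Nat.Div0.add_mod_idemp_l k).
  generalize dependent (k mod N)%nat; intros l Hl; case_mods N; lia.
Qed.

Lemma cell_point_realization k u v :
  0 <= u <= 1 -> 0 <= v <= 1 -> realization N n1 n2 n3 (cell_point k u v).
Proof.
  intros Hu Hv. assert (HN : (N <> 0)%nat) by lia. apply realization_face.
  destruct (Rle_dec v u) as [Hvu|Hvu].
  - exists (lower_triangle k); split; [apply lower_triangle_simplex|].
    rewrite cell_point_lower by lra; apply bary_face; try (apply Nat.mod_upper_bound, HN); lra.
  - exists (upper_triangle k); split; [apply upper_triangle_simplex|].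
    rewrite cell_point_upper by lra; apply bary_face; try (apply Nat.mod_upper_bound, HN); lra.
Qed.

Lemma cell_point_surjective x :
  realization N n1 n2 n3 x ->
  exists k u v, 0 <= u <= 1 /\ 0 <= v <= 1 /\ x = cell_point k u v.
Proof.
  intros Hx; apply realization_face in Hx; destruct Hx as (s & Hs & Hx).
  destruct (simplex_in_triangle s Hs) as (k & Hincl); exists k.
  destruct (cell_vertices_distinct k) as (D01 & D02 & D03 & D13 & D23).
  assert (Hlt : forall l, (l mod N < N)%nat) by (intros; apply Nat.mod_upper_bound; lia).
  assert (Hpos : forall i, 0 <= x i) by apply Hx.
  destruct Hincl as [Hincl|Hincl]; apply (face_incl _ _ _ _ Hincl) in Hx.
  - assert (Hsum := face_sum N _ _ _ x (Hlt _) (Hlt _) (Hlt _) D01 D03 D13 Hx).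
    apply face_bary in Hx; auto. rewrite Hx.
    set (b := x ((k + n1) mod N)%nat) in *. set (c := x ((k + (n1 + n2)) mod N)%nat) in *.
    assert (0 <= x (k mod N)%nat) by auto. assert (0 <= b) by apply Hpos.
    assert (0 <= c) by apply Hpos.
    exists (b + c), c; split; [lra|]; split; [lra|]. rewrite cell_point_lower by lra. f_equal; lra.
  - apply not_eq_sym in D02, D03, D23.
    assert (Hsum := face_sum N _ _ _ x (Hlt _) (Hlt _) (Hlt _) D23 D03 D02 Hx).
    apply face_bary in Hx; auto. rewrite Hx.
    set (b := x ((k + n2) mod N)%nat) in *. set (c := x ((k + (n1 + n2)) mod N)%nat) in *.
    assert (0 <= x (k mod N)%nat) by auto. assert (0 <= b) by apply Hpos.
    assert (0 <= c) by apply Hpos.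
    exists c, (b + c); split; [lra|]; split; [lra|]. rewrite cell_point_upper by lra. f_equal; lra.
Qed.

Lemma cell_point_support k u v i :
  cell_point k u v i <> 0 ->
  exists ea eb, (ea < 2)%nat /\ (eb < 2)%nat /\
    hat (u - INR ea) (v - INR eb) <> 0 /\ i = ((k + (ea * n1 + eb * n2)) mod N)%nat.
Proof.
  intros Hi; apply rsum_nonzero_term in Hi; destruct Hi as (ea & Ha & Hi).
  apply rsum_nonzero_term in Hi; destruct Hi as (eb & Hb & Hi).
  exists ea, eb; repeat split; auto; [intros E; apply Hi; rewrite E; ring|].
  apply NNPP; intros Hne; apply Hi; rewrite kronecker_diff by exact Hne; ring.
Qed.

(* Position of a point [x] of the star of the vertex [i] relative to the lifts of [i].  Since
   [n1 + n2 + n3 = N], the neighbours [i - n1], [i - n2], [i - n1 - n2] are [i + (n2 + n3)],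
   [i + (n1 + n3)], [i + n3]. *)
Definition star_abscissa (i : nat) (x : nat -> R) : R :=
  x ((i + n1) mod N)%nat + x ((i + (n1 + n2)) mod N)%nat
  - x ((i + (n2 + n3)) mod N)%nat - x ((i + n3) mod N)%nat.

Definition star_ordinate (i : nat) (x : nat -> R) : R :=
  x ((i + n2) mod N)%nat + x ((i + (n1 + n2)) mod N)%nat
  - x ((i + (n1 + n3)) mod N)%nat - x ((i + n3) mod N)%nat.

Lemma kronecker_mod_shift k e f :
  kronecker ((k + e) mod N) ((k + f) mod N) = kronecker (e mod N) (f mod N).
Proof.
  assert (Hiff : ((k + f) mod N = (k + e) mod N <-> f mod N = e mod N)%nat).
  { rewrite !nat_mod_eq_Z by lia.
    replace (Z.of_nat (k + f) - Z.of_nat (k + e))%Z with (Z.of_nat f - Z.of_nat e)%Z by lia.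
    reflexivity. }
  unfold kronecker.
  destruct (Nat.eqb_spec ((k + f) mod N) ((k + e) mod N)),
    (Nat.eqb_spec (f mod N) (e mod N)); tauto.
Qed.

Lemma cell_point_at k e u v :
  cell_point k u v ((k + e) mod N)%nat =
    hat u v * kronecker 0 (e mod N) + hat (u - 1) v * kronecker n1 (e mod N) +
    hat u (v - 1) * kronecker n2 (e mod N) + hat (u - 1) (v - 1) * kronecker (n1 + n2) (e mod N).
Proof.
  rewrite cell_point_corners.
  assert (E0 : (k mod N = (k + 0) mod N)%nat) by (f_equal; lia).
  rewrite E0, !kronecker_mod_shift.
  rewrite (Nat.mod_small 0), (Nat.mod_small n1), (Nat.mod_small n2), (Nat.mod_small (n1 + n2))
    by lia.
  reflexivity.
Qed.

Ltac eval_kroneckers := unfold kronecker;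
  repeat match goal with
  | |- context [Nat.eqb ?a ?b] =>
      first [ rewrite (proj2 (Nat.eqb_neq a b)) by lia
            | rewrite (proj2 (Nat.eqb_eq a b)) by lia
            | destruct (Nat.eqb_spec a b) ]
  end.

(* Here the six neighbours of a vertex need to be distinct. *)
Lemma star_coordinates k u v ea eb :
  0 <= u <= 1 -> 0 <= v <= 1 -> (ea < 2)%nat -> (eb < 2)%nat ->
  hat (u - INR ea) (v - INR eb) <> 0 ->
  star_abscissa (k + (ea * n1 + eb * n2)) (cell_point k u v) = u - INR ea /\
  star_ordinate (k + (ea * n1 + eb * n2)) (cell_point k u v) = v - INR eb.
Proof.
  intros Hu Hv Ha Hb Hw. unfold star_abscissa, star_ordinate.
  rewrite <- !(Nat.add_assoc k), !cell_point_at.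
  destruct (Rle_dec v u) as [Hvu|Hvu];
    [destruct (hat_lower u v) as (H00 & H10 & H01 & H11)
    |destruct (hat_upper u v) as (H00 & H10 & H01 & H11)]; try lra;
    rewrite H00, H10, H01, H11;
    destruct ea as [|[|ea]], eb as [|[|eb]]; try lia; cbn [INR Nat.mul Nat.add] in Hw |- *;
    rewrite ?Nat.add_0_r, ?Rminus_0_r in *; case_mods N; eval_kroneckers; lra.
Qed.

Definition cover : space := fun x =>
  in_Rd 3 x /\ 0 <= x 0%nat <= INR N /\ 0 <= x 1%nat <= INR N /\
  exists j, (j < g)%nat /\ x 2%nat = INR j.

(* On [cover] only the vertices [(a, b)] with [0 <= a, b <= N + 1] contribute. *)
Definition cover_map (x : nat -> R) (i : nat) : R :=
  rsum (N + 2) (fun a => rsum (N + 2) (fun b =>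
    hat (x 0%nat - INR a) (x 1%nat - INR b) *
    rsum g (fun j => bump (x 2%nat - INR j) * kronecker ((j + (a * n1 + b * n2)) mod N) i))).

Lemma cover_compact : seq_compact 3 cover.
Proof.
  apply (closed_bounded_compact 3 cover (INR N + INR g)).
  - intros x Hx; apply Hx.
  - intros x i (_ & Hs & Ht & j & Hj & Ej) Hi; apply lt_INR in Hj; assert (Hj0 := pos_INR j).
    revert i Hi; apply forall_lt_3; apply Rabs_le_between; lra.
  - intros l Hin Hl; split; [exact Hin|].
    assert (Hcoord : forall i, (i < 3)%nat -> continuous_real 3 (fun _ => True) (fun x => x i))
      by (intros; continuity_real).
    split; [|split].
    + split; [apply (adherent_ge 3 cover (fun x => x 0%nat))
             |apply (adherent_le 3 cover (fun x => x 0%nat))]; auto; intros x Hx; apply Hx.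
    + split; [apply (adherent_ge 3 cover (fun x => x 1%nat))
             |apply (adherent_le 3 cover (fun x => x 1%nat))]; auto; intros x Hx; apply Hx.
    + destruct (adherent_exists_lt 3 cover (fun j x => x 2%nat = INR j) g l) as (j & Hj & Hlj);
        [intros x Hx; apply Hx|exact Hl|].
      exists j; split; [exact Hj|].
      apply (adherent_eq 3 (fun x => x 2%nat = INR j) (fun x => x 2%nat)); auto.
Qed.

Lemma cover_map_continuous : continuous_on 3 N cover cover_map.
Proof.
  apply continuous_on_coords; intros i Hi; unfold cover_map, hat, bump; continuity_real.
Qed.

Lemma cover_map_local x A B j u v :
  (A <= N)%nat -> (B <= N)%nat -> (j < g)%nat -> 0 <= u <= 1 -> 0 <= v <= 1 ->
  x 0%nat = INR A + u -> x 1%nat = INR B + v -> x 2%nat = INR j ->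
  cover_map x = cell_point (j + (A * n1 + B * n2)) u v.
Proof.
  intros HA HB Hj Hu Hv E0 E1 E2; apply functional_extensionality; intros i.
  set (F := fun a b => hat (INR A + u - INR a) (INR B + v - INR b) *
    kronecker ((j + (a * n1 + b * n2)) mod N) i).
  transitivity (rsum (N + 2) (fun a => rsum (N + 2) (fun b => F a b))).
  { apply rsum_ext; intros a _; apply rsum_ext; intros b _; unfold F. rewrite E0, E1; f_equal.
    rewrite <- (rsum_kronecker_mul g j (fun l => kronecker ((l + (a * n1 + b * n2)) mod N) i) Hj).
    apply rsum_ext; intros l _; rewrite E2, bump_INR; reflexivity. }
  rewrite (rsum_two_terms (N + 2) A); [|lia|].
  2: { intros a _ HaA HaS; apply rsum_0; intros b _; unfold F.
       rewrite hat_far; [ring|left; apply far_from_cell; assumption]. }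
  apply rsum_ext; intros ea _. rewrite (rsum_two_terms (N + 2) B); [|lia|].
  2: { intros b _ HbB HbS; unfold F.
       rewrite hat_far; [ring|right; apply far_from_cell; assumption]. }
  apply rsum_ext; intros eb _; unfold F. rewrite !plus_INR.
  f_equal; [f_equal; ring|do 2 f_equal; lia].
Qed.

Lemma cover_cell x :
  cover x -> exists A B j u v, (j < g)%nat /\ 0 <= u < 1 /\ 0 <= v < 1 /\
    x 0%nat = INR A + u /\ x 1%nat = INR B + v /\ x 2%nat = INR j /\
    cover_map x = cell_point (j + (A * n1 + B * n2)) u v.
Proof.
  intros (Hin & Hs & Ht & j & Hj & Ej).
  assert (Hfloor : forall s, 0 <= s <= INR N ->
    exists A u, (A <= N)%nat /\ 0 <= u < 1 /\ s = INR A + u).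
  { intros s Hs'. destruct (nfloor_ex s ltac:(lra)) as [A HA].
    exists A, (s - INR A); split; [apply INR_le; lra|split; lra]. }
  destruct (Hfloor _ Hs) as (A & u & HA & Hu & E0).
  destruct (Hfloor _ Ht) as (B & v & HB & Hv & E1).
  exists A, B, j, u, v; repeat split; try assumption; try lra.
  apply cover_map_local; auto; lra.
Qed.

Lemma cover_map_realization x : cover x -> realization N n1 n2 n3 (cover_map x).
Proof.
  intros Hx; destruct (cover_cell x Hx) as (A & B & j & u & v & _ & Hu & Hv & _ & _ & _ & ->).
  apply cell_point_realization; lra.
Qed.

Lemma cover_map_surjective x :
  realization N n1 n2 n3 x -> exists z, cover z /\ cover_map z = x.
Proof.
  intros Hx; assert (HN : (0 < N)%nat) by lia.
  destruct (cell_point_surjective x Hx) as (k & u & v & Hu & Hv & ->).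
  destruct (vertex_reached N n1 n2 HN k) as (A & B & HA & HB & E); fold g in E.
  assert (Hg : (k mod g < g)%nat)
    by (apply Nat.mod_upper_bound, Nat.neq_0_lt_0, component_count_pos, HN).
  apply le_INR in HA, HB; rewrite S_INR in HA, HB.
  assert (HA0 := pos_INR A). assert (HB0 := pos_INR B).
  set (z := fun i => match i with
    | 0%nat => INR A + u | 1%nat => INR B + v | 2%nat => INR (k mod g) | _ => 0 end).
  exists z; split.
  - split; [intros [|[|[|i]]] Hi; try lia; reflexivity|].
    split; [simpl; lra|]; split; [simpl; lra|]. exists (k mod g)%nat; split; [exact Hg|reflexivity].
  - rewrite (cover_map_local z A B (k mod g) u v); auto; try (apply INR_le; lra).
    apply cell_point_mod; rewrite Nat.add_assoc; exact E.
Qed.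

Definition period_equivalent (x y : nat -> R) : Prop :=
  x 2%nat = y 2%nat /\ exists a b : Z,
    x 0%nat - y 0%nat = IZR a /\ x 1%nat - y 1%nat = IZR b /\
    (Z.of_nat N | a * Z.of_nat n1 + b * Z.of_nat n2)%Z.

Lemma star_coordinates_vertex k u v i :
  0 <= u <= 1 -> 0 <= v <= 1 -> cell_point k u v i <> 0 ->
  exists ea eb, i = ((k + (ea * n1 + eb * n2)) mod N)%nat /\
    star_abscissa i (cell_point k u v) = u - INR ea /\
    star_ordinate i (cell_point k u v) = v - INR eb.
Proof.
  intros Hu Hv Hi; destruct (cell_point_support k u v i Hi) as (ea & eb & Ha & Hb & Hw & Ei).
  exists ea, eb; split; [exact Ei|].
  destruct (star_coordinates k u v ea eb Hu Hv Ha Hb Hw) as [<- <-].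
  rewrite Ei; unfold star_abscissa, star_ordinate.
  rewrite !Nat.Div0.add_mod_idemp_l; split; reflexivity.
Qed.

Lemma cover_map_fibre_equivalent x y :
  cover x -> cover y -> cover_map x = cover_map y -> period_equivalent x y.
Proof.
  intros Hx Hy E.
  destruct (cover_map_realization x Hx) as (_ & _ & Hsum & _).
  destruct (cover_cell x Hx) as (A & B & j & u & v & Hj & Hu & Hv & X0 & X1 & X2 & Ex).
  destruct (cover_cell y Hy) as (A' & B' & j' & u' & v' & Hj' & Hu' & Hv' & Y0 & Y1 & Y2 & Ey).
  destruct (rsum_nonzero_term N (cover_map x)) as (i & _ & Hi); [rewrite Hsum; lra|].
  assert (Hi' := Hi). rewrite E, Ey in Hi'. rewrite Ex in Hi.
  destruct (star_coordinates_vertex _ u v i ltac:(lra) ltac:(lra) Hi) as (ea & eb & Ei & Ss & St).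
  destruct (star_coordinates_vertex _ u' v' i ltac:(lra) ltac:(lra) Hi')
    as (ea' & eb' & Ei' & Ss' & St').
  rewrite <- Ex, E, Ey in Ss, St.
  assert (Ev : ((j + (A + ea) * n1 + (B + eb) * n2) mod N =
                (j' + (A' + ea') * n1 + (B' + eb') * n2) mod N)%nat).
  { transitivity i; [rewrite Ei|rewrite Ei']; f_equal; lia. }
  assert (Ejj : j = j')
    by (apply (component_unique N n1 n2 ltac:(lia) _ _ _ _ _ _ Hj Hj' Ev)).
  split; [rewrite X2, Y2, Ejj; reflexivity|].
  exists (Z.of_nat (A + ea) - Z.of_nat (A' + ea'))%Z, (Z.of_nat (B + eb) - Z.of_nat (B' + eb'))%Z.
  rewrite !minus_IZR, <- !INR_IZR_INZ, !plus_INR.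
  split; [lra|]; split; [lra|].
  apply nat_mod_eq_Z in Ev; [|lia]. destruct Ev as [c Hc]; exists c. rewrite <- Hc, Ejj. nia.
Qed.

Lemma integer_part_diff (A B : nat) (u v : R) (c : Z) :
  0 <= u < 1 -> 0 <= v < 1 -> INR A + u - (INR B + v) = IZR c ->
  (Z.of_nat A - Z.of_nat B = c)%Z /\ u = v.
Proof.
  intros Hu Hv E; rewrite !INR_IZR_INZ in E.
  assert (Ec : (Z.of_nat A - Z.of_nat B = c)%Z).
  { assert (Hlt : IZR (Z.of_nat A - Z.of_nat B - c) < IZR 1) by (rewrite !minus_IZR; lra).
    assert (Hgt : IZR (-1) < IZR (Z.of_nat A - Z.of_nat B - c)) by (rewrite !minus_IZR; lra).
    apply lt_IZR in Hlt, Hgt; lia. }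
  split; [exact Ec|]. rewrite <- Ec, minus_IZR in E; lra.
Qed.

Lemma period_equivalent_cover_map x y :
  cover x -> cover y -> period_equivalent x y -> cover_map x = cover_map y.
Proof.
  intros Hx Hy (E2 & a & b & Ea & Eb & [c Hc]).
  destruct (cover_cell x Hx) as (A & B & j & u & v & Hj & Hu & Hv & X0 & X1 & X2 & ->).
  destruct (cover_cell y Hy) as (A' & B' & j' & u' & v' & Hj' & Hu' & Hv' & Y0 & Y1 & Y2 & ->).
  assert (Ej : j = j') by (apply INR_eq; lra). subst j'.
  rewrite X0, Y0 in Ea; rewrite X1, Y1 in Eb.
  destruct (integer_part_diff A A' u u' a Hu Hu' Ea) as [Ca ->].
  destruct (integer_part_diff B B' v v' b Hv Hv' Eb) as [Cb ->].
  apply cell_point_mod, nat_mod_eq_Z; [lia|].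
  exists c. rewrite <- Hc, <- Ca, <- Cb. lia.
Qed.

Section Parametrization.

Variables p q r : Z.
Hypothesis p_pos : (0 < p)%Z.
Hypothesis q_pos : (0 < q)%Z.
Hypothesis period_basis : forall a b,
  (Z.of_nat N | a * Z.of_nat n1 + b * Z.of_nat n2)%Z <->
  exists m n, (a = m * p + n * r /\ b = n * q)%Z.

(* Coordinates with respect to the basis [(p, 0)], [(r, q)] of the period lattice. *)
Definition longitude (x : nat -> R) : R :=
  2 * PI * ((x 0%nat - IZR r * (x 1%nat * / IZR q)) * / IZR p).

Definition latitude (x : nat -> R) : R := 2 * PI * (x 1%nat * / IZR q).

Definition torus_map (x : nat -> R) (i : nat) : R :=
  match i with
  | 0%nat => (2 + cos (latitude x)) * cos (longitude x)
  | 1%nat => (2 + cos (latitude x)) * sin (longitude x)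
  | 2%nat => sin (latitude x)
  | 3%nat => x 2%nat
  | _ => 0
  end.

Lemma torus_map_in_Rd x : in_Rd 4 (torus_map x).
Proof. intros [|[|[|[|i]]]] Hi; try lia; reflexivity. Qed.

Lemma torus_map_continuous : continuous_on 3 4 cover torus_map.
Proof.
  apply continuous_on_coords; apply forall_lt_4; unfold torus_map, latitude, longitude;
    continuity_real.
Qed.

Lemma torus_radius t l :
  sqrt (((2 + cos t) * cos l) ^ 2 + ((2 + cos t) * sin l) ^ 2) = 2 + cos t.
Proof.
  assert (Hcos := COS_bound t). assert (Hpyth := sin2_cos2 l). unfold Rsqr in Hpyth.
  replace (((2 + cos t) * cos l) ^ 2 + ((2 + cos t) * sin l) ^ 2)
    with ((2 + cos t) ^ 2 * (sin l * sin l + cos l * cos l)) by ring.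
  rewrite Hpyth, Rmult_1_r. apply sqrt_pow2; lra.
Qed.

Lemma torus_map_tori x : cover x -> tori g (torus_map x).
Proof.
  intros (_ & _ & _ & Hj); split; [apply torus_map_in_Rd|].
  split; [exact Hj|]. cbn [torus_map]. rewrite torus_radius.
  assert (Hpyth := sin2_cos2 (latitude x)). unfold Rsqr in Hpyth. lra.
Qed.

Lemma period_equivalent_angles x y :
  period_equivalent x y <-> x 2%nat = y 2%nat /\
    (exists m : Z, longitude x = longitude y + 2 * PI * IZR m) /\
    (exists n : Z, latitude x = latitude y + 2 * PI * IZR n).
Proof.
  assert (Hp : 0 < IZR p) by (apply IZR_lt, p_pos).
  assert (Hq : 0 < IZR q) by (apply IZR_lt, q_pos).
  assert (HPI := PI_RGT_0). unfold longitude, latitude.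
  split.
  - intros (E2 & a & b & Ea & Eb & Hd); split; [exact E2|].
    apply period_basis in Hd. destruct Hd as (m & n & -> & ->).
    rewrite plus_IZR, !mult_IZR in Ea. rewrite mult_IZR in Eb.
    replace (x 0%nat) with (y 0%nat + (IZR m * IZR p + IZR n * IZR r)) by lra.
    replace (x 1%nat) with (y 1%nat + IZR n * IZR q) by lra.
    split; [exists m|exists n]; field; lra.
  - intros (E2 & [m Em] & [n En]); split; [exact E2|].
    exists (m * p + n * r)%Z, (n * q)%Z. rewrite plus_IZR, !mult_IZR.
    assert (E1 : x 1%nat = y 1%nat + IZR n * IZR q).
    { apply (Rmult_eq_reg_l (2 * PI * / IZR q)).
      - transitivity (2 * PI * (x 1%nat * / IZR q)); [ring|]. rewrite En; field; lra.
      - apply Rgt_not_eq, Rmult_lt_0_compat; [lra|apply Rinv_0_lt_compat, Hq]. }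
    assert (E0 : x 0%nat = y 0%nat + IZR m * IZR p + IZR n * IZR r).
    { apply (Rmult_eq_reg_l (2 * PI * / IZR p)).
      - apply (Rplus_eq_reg_r (- (2 * PI * / IZR p * IZR r * / IZR q * x 1%nat))).
        transitivity (2 * PI * ((x 0%nat - IZR r * (x 1%nat * / IZR q)) * / IZR p)); [ring|].
        rewrite Em, E1; field; lra.
      - apply Rgt_not_eq, Rmult_lt_0_compat; [lra|apply Rinv_0_lt_compat, Hp]. }
    split; [lra|]; split; [lra|]. apply period_basis; exists m, n; auto.
Qed.

Lemma torus_map_fibre x y : torus_map x = torus_map y <-> period_equivalent x y.
Proof.
  rewrite period_equivalent_angles, <- !cos_sin_eq. split.
  - intros E. assert (Ei := fun i => f_equal (fun z => z i) E).
    assert (E0 := Ei 0%nat). assert (E1 := Ei 1%nat).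
    assert (E2 := Ei 2%nat). assert (E3 := Ei 3%nat). cbn [torus_map] in E0, E1, E2, E3.
    assert (Hr := torus_radius (latitude x) (longitude x)).
    rewrite E0, E1, torus_radius in Hr.
    assert (Ec : cos (latitude x) = cos (latitude y)) by lra.
    assert (Hcos := COS_bound (latitude y)). rewrite Ec in E0, E1.
    split; [exact E3|]; split; [|split; assumption].
    split; apply (Rmult_eq_reg_l (2 + cos (latitude y))); lra.
  - intros (E2 & [Cl Sl] & [Ct St]).
    apply functional_extensionality; intros i; unfold torus_map.
    rewrite Cl, Sl, Ct, St, E2; reflexivity.
Qed.

Lemma tori_angles y :
  tori g y -> exists l t, y 0%nat = (2 + cos t) * cos l /\ y 1%nat = (2 + cos t) * sin l /\
    y 2%nat = sin t.
Proof.
  intros (_ & _ & E). set (rho := sqrt (y 0%nat ^ 2 + y 1%nat ^ 2)) in *.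
  assert (Hrho : 1 <= rho) by nra.
  assert (Hrho2 : rho ^ 2 = y 0%nat ^ 2 + y 1%nat ^ 2)
    by (apply pow2_sqrt, Rplus_le_le_0_compat; apply pow2_ge_0).
  destruct (unit_circle_angle (y 0%nat / rho) (y 1%nat / rho)) as (l & Cl & Sl).
  { transitivity ((y 0%nat ^ 2 + y 1%nat ^ 2) / rho ^ 2); [field; lra|].
    rewrite <- Hrho2; field; lra. }
  destruct (unit_circle_angle (rho - 2) (y 2%nat) E) as (t & Ct & St).
  exists l, t; rewrite Cl, Sl, Ct, St; repeat split; field; lra.
Qed.

Lemma torus_map_surjective y : tori g y -> exists x, cover x /\ torus_map x = y.
Proof.
  intros Hy; destruct (tori_angles y Hy) as (l & t & Y0 & Y1 & Y2).
  destruct Hy as (Hin & (j & Hj & Ej) & _).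
  assert (Hp : 0 < IZR p) by (apply IZR_lt, p_pos).
  assert (Hq : 0 < IZR q) by (apply IZR_lt, q_pos).
  assert (HPI := PI_RGT_0).
  assert (HN0 : 0 < INR N) by (apply lt_0_INR; lia).
  set (point := fun s0 t0 (i : nat) => match i with
    | 0%nat => s0 | 1%nat => t0 | 2%nat => INR j | _ => 0 end).
  set (t0 := t / (2 * PI) * IZR q). set (s0 := l / (2 * PI) * IZR p + IZR r * (t / (2 * PI))).
  destruct (real_shift_into_range (INR N) s0 HN0) as (m & Hm).
  destruct (real_shift_into_range (INR N) t0 HN0) as (n & Hn).
  exists (point (s0 + INR N * IZR m) (t0 + INR N * IZR n)); split.
  - split; [intros [|[|[|i]]] Hi; try lia; reflexivity|].
    split; [exact Hm|]; split; [exact Hn|]. exists j; split; [exact Hj|reflexivity].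
  - transitivity (torus_map (point s0 t0)).
    + apply torus_map_fibre. split; [reflexivity|].
      exists (Z.of_nat N * m)%Z, (Z.of_nat N * n)%Z.
      rewrite !mult_IZR, <- !INR_IZR_INZ. simpl.
      split; [ring|]; split; [ring|].
      exists (m * Z.of_nat n1 + n * Z.of_nat n2)%Z; ring.
    + assert (El : longitude (point s0 t0) = l)
        by (unfold longitude; simpl; unfold s0, t0; field; lra).
      assert (Et : latitude (point s0 t0) = t)
        by (unfold latitude; simpl; unfold t0; field; lra).
      apply (in_Rd_ext 4); [apply torus_map_in_Rd|exact Hin|].
      apply forall_lt_4; cbn [torus_map]; rewrite ?El, ?Et; symmetry; assumption.
Qed.

Lemma generic_complex_tori_of_basis : homeomorphic N (realization N n1 n2 n3) 4 (tori g).
Proof.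
  apply (homeomorphic_of_same_fibres 3 N 4 cover _ _ cover_map torus_map).
  - exact cover_compact.
  - intros x Hx; apply Hx.
  - intros x Hx; apply Hx.
  - exact cover_map_realization.
  - exact cover_map_surjective.
  - exact torus_map_tori.
  - exact torus_map_surjective.
  - exact cover_map_continuous.
  - exact torus_map_continuous.
  - intros x y Hx Hy; rewrite torus_map_fibre; split.
    + apply cover_map_fibre_equivalent; assumption.
    + apply period_equivalent_cover_map; assumption.
Qed.

End Parametrization.

Lemma generic_complex_tori : homeomorphic N (realization N n1 n2 n3) 4 (tori g).
Proof.
  destruct (period_lattice_basis (Z.of_nat N) (Z.of_nat n1) (Z.of_nat n2) ltac:(lia))
    as (p & q & r & Hp & Hq & Hbasis).
  apply (generic_complex_tori_of_basis p q r); assumption.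
Qed.

End Torus.

Theorem theorem6p7 (N n1 n2 n3 : nat)
  (h1 : (1 <= n1)%nat) (h12 : (n1 <= n2)%nat) (h23 : (n2 <= n3)%nat)
  (h3N : (n3 < N)%nat) (hsum : (n1 + n2 + n3)%nat = N) :
  is_surface N (realization N n1 n2 n3) ->
  (exists k, homeomorphic N (realization N n1 n2 n3) 4 (tori k)) \/
  (exists k, homeomorphic N (realization N n1 n2 n3) 4 (spheres k)).
Proof.
  intros Hsurf.
  destruct (Nat.eq_dec n1 n2) as [<-|Hne12].
  - destruct (Nat.eq_dec n3 (2 * n1)) as [->|Hne].
    + right; exists n1; apply tetrahedral_complex_spheres; lia.
    + exfalso; exact (equal_n1_n2_not_surface N n1 n3 h1 h23 hsum Hne Hsurf).
  - destruct (Nat.eq_dec n2 n3) as [<-|Hne23].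
    + exfalso; apply (equal_n2_n3_not_surface N n1 n2 h1 ltac:(lia) hsum Hsurf).
    + destruct (Nat.eq_dec n3 (n1 + n2)) as [Heq|Hne].
      * exfalso; apply (n3_eq_n1_plus_n2_not_surface N n1 n2 n3 h1 ltac:(lia) Heq hsum Hsurf).
      * left; exists (component_count N n1 n2); apply generic_complex_tori; lia.
Qed.
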